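(* Let $S\subseteq[n-1]$, and let $\rho,\sigma\in\mathfrak S_n$ with $w_0(S)\preceq_L\rho$ and $\sigma\preceq_L w_1(S)$. Let $C_{S;\rho}$ and $C_{\sigma;S}$ be the $\sim_D$-equivalence classes in $\mathrm{Int}(n)$ of $[w_0(S),\rho]_L$ and $[\sigma,w_1(S)]_L$, respectively. (a) If $\mathscr D:=D_{S;\rho}$ is free of a strictly upper-right configuration, then $$\max C_{S;\rho}=\Sigma_L(P_{F_{\mathscr D}^{\rightarrow}})=[\mathrm w_{LT}(T'_{\mathscr D}),\,w_1(\mathrm{set}(\mathsf r(\mathscr D)))]_L .$$ Furthermore $C_{S;\rho}=\{\Sigma_L(P_{T^x}): T\in\mathsf{ST}(\mathscr D^x)\}$, and $(C_{S;\rho},\preceq)\cong(\mathsf{ST}(\mathscr D^x),\trianglelefteq)$ as posets. (b) If $\mathscr E:=D_{\sigma;S}$ is free of a strictly upper-right configuration, then $$\min C_{\sigma;S}=\Sigma_L(P_{F_{\mathscr E}^{\downarrow}})=[w_0(\mathrm{set}(\mathsf c(\mathscr E))^{c}),\,\mathrm w_{TL}(T_{\mathscr E})]_L .$$ Furthermore $C_{\sigma;S}=\{\Sigma_L(P_{T^x}): T\in\mathsf{ST}(\mathscr E^x)\}$, and $(C_{\sigma;S},\preceq)\cong(\mathsf{ST}(\mathscr E^x),\trianglelefteq)$ as posets.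
   Context: Permutations. $n$ is a positive integer, $[n]=\{1,\dots,n\}$, $\mathfrak S_n$ the symmetric group (product = composition of maps; permutations written as words), $s_i=(i,i+1)$, $\ell$ Coxeter length, $w_0$ the longest element. $\mathrm{Des}_L(\sigma)=\{i:\ell(s_i\sigma)<\ell(\sigma)\}$, $\mathrm{Des}_R(\sigma)=\{i:\ell(\sigma s_i)<\ell(\sigma)\}$. $\preceq_L$ (resp. $\preceq_R$) has covers $\sigma\prec s_i\sigma$, $i\notin\mathrm{Des}_L(\sigma)$ (resp. $\sigma\prec\sigma s_i$, $i\notin\mathrm{Des}_R(\sigma)$); $[\sigma,\rho]_L$ is the interval for $\preceq_L$. For $S\subseteq[n-1]$, $S^{c}=[n-1]\setminus S$; $w_0(S)$ is the longest element of the subgroup generated by $\{s_i:i\in S\}$; $w_1(S)=w_0w_0(S^c)$ is the longest element of $\{z:\mathrm{Des}_R(z)\subseteq S\}$. For a composition $\alpha=(\alpha_1,\dots,\alpha_l)$ of $n$, $\mathrm{set}(\alpha)=\{\alpha_1,\alpha_1+\alpha_2,\dots,\alpha_1+\dots+\alpha_{l-1}\}$. Classes. $\mathrm{Int}(n)$ is the set of nonempty intervals $[\sigma,\rho]_L$. $I_1\sim_D I_2$ iff there is a poset isomorphism $f:(I_1,\preceq_L)\to(I_2,\preceq_L)$ with $\mathrm{Des}_L(f(\gamma))=\mathrm{Des}_L(\gamma)$ for all $\gamma$. On an equivalence class $C$ put $[\sigma,\rho]_L\preceq[\sigma',\rho']_L$ iff $\sigma\preceq_R\sigma'$; it is known that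 $(C,\preceq)$ has a minimum $\min C$ and a maximum $\max C$. Diagrams. $\mathfrak D_n$ is the set of $n$-element subsets $D\subset\mathbb Z_{>0}^2$ (boxes $(x,y)$, $x$ = column index from the left, $y$ = row index from the bottom) with no empty row or column up to the number of rows/columns. $\mathsf r(D)$ (resp. $\mathsf c(D)$) is the composition of $n$ listing the numbers of boxes in rows from top to bottom (resp. in columns from left to right). $D^x$ is the reflection of $D$ across the $x$-axis, shifted to lie in $\mathfrak D_n$; for a filling $F$ of a diagram, $F^x$ is the correspondingly reflected filling. $D$ is free of a strictly upper-right configuration if there are no two boxes $(x_1,y_1),(x_2,y_2)\in D$ with $x_1<x_2$, $y_1<y_2$ such that no other box of $D$ lies in the smallest rectangle containing both. Fillings. A standard filling of $D$ is a bijection $F:D\to[n]$; $P_F$ is the poset on $[n]$ with $i\preceq j$ iff $x_i\le x_j$ and $y_i\le y_j$, where $(x_i,y_i)=F^{-1}(i)$. For a poset $P$ on $[n]$, $\Sigma_L(P)=\{\sigma\in\mathfrak S_n:\sigma(i)\le\sigma(j)\text{ whenever }i\preceq_P j\}$. $F_D^{\downarrow}$ places $1,\dots,n$ down columns (top to bottom), leftmost column first; $F_D^{\rightarrow}$ places $1,\dots,n$ along rows left to right, top row first. $\mathsf{ST}(D)$ is the set of standard tableaux: standard fillings $T$ with $T(i,j)\le T(k,l)$ whenever $i\le k$, $j\le l$. $T'_D$ places $1,\dots,n$ up columns (bottom to top), leftmost column first; $T_D$ places $1,\dots,n$ along rows left to right, bottom row first. Reading words: $\mathrm w_{TL}$ reads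 each column top to bottom, leftmost column first; $\mathrm w_{LT}$ reads each row left to right, top row first. On $\mathsf{ST}(D)$: $T\trianglelefteq U$ iff $\mathrm w_{TL}(T)\preceq_L\mathrm w_{TL}(U)$. The diagram $D_{S;\rho}$. Write $S^c=\{z_1<\dots<z_p\}$, $z_0=0$, $z_{p+1}=n$, and $\mathrm{Des}_L(\rho)=\{q_1<\dots<q_e\}$, $q_0=0$, $q_{e+1}=n$; $X_i=\{\rho(r):z_{i-1}+1\le r\le z_i\}$, $Y_j=\{c:q_{j-1}+1\le c\le q_j\}$; $D_{S;\rho}=\{(i,j):X_i\cap Y_j\ne\emptyset\}$. The diagram $D_{\sigma;S}$. Write $S=\{z_1<\dots<z_p\}$, $z_0=0$, $z_{p+1}=n$, and $[n-1]\setminus\mathrm{Des}_L(\sigma)=\{q_1<\dots<q_e\}$, $q_0=0$, $q_{e+1}=n$; $D_{\sigma;S}=\{(j,p+2-i):\{\sigma(r):z_{i-1}<r\le z_i\}\cap\{q_{j-1}+1,\dots,q_j\}\ne\emptyset\}$. *)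

(* Defs.v *)
From mathcomp Require Import all_boot all_fingroup.

Set Implicit Arguments.
Unset Strict Implicit.
Unset Printing Implicit Defensive.

(* Conventions. The positive integer called n in the mathematics is [n.+1]
   here, and everything is indexed from 0: the element k of [n] is the ordinal
   k-1 of 'I_n.+1, the element i of [n-1] is the ordinal i-1 of 'I_n, and the
   box (x, y) of a diagram (x-th column from the left, y-th row from the
   bottom) is the pair (x-1, y-1). *)

(* MathComp composes permutations from left to right: (s * t) k = t (s k). *)
Definition pcomp (n : nat) (s t : 'S_n) : 'S_n := (t * s)%g.

Definition simple (n : nat) (i : 'I_n) : 'S_n.+1 :=
  tperm (widen_ord (leqnSn n) i) (lift ord0 i).

Definition has_word (n : nat) (s : 'S_n.+1) (k : nat) : bool :=
  [exists w : k.-tuple 'I_n, s == (\prod_(i <- w) simple i)%g].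

Lemma ex_word (n : nat) (s : 'S_n.+1) : exists k, has_word s k.
Proof.
set H := <<[set simple i | i : 'I_n]>>%g.
have tpermH d (x y : 'I_n.+1) : y = x + d :> nat -> tperm x y \in H.
  elim: d y => [|d IHd] y.
    rewrite addn0 => /val_inj ->.
    by rewrite tperm1 group1.
  move=> Dy; have ltdn : x + d < n by rewrite -ltnS -addnS -Dy.
  pose i := Ordinal ltdn.
  have siH : simple i \in H by rewrite mem_gen ?imset_f.
  have Dyi : y = lift ord0 i by apply: val_inj; rewrite /= Dy addnS.
  have [d0 | d_gt0] := posnP d.
    suff -> : tperm x y = simple i by [].
    by rewrite /simple Dyi; congr tperm; apply: val_inj; rewrite /= d0 addn0.
  have IH : tperm x (widen_ord (leqnSn n) i) \in H by apply: IHd.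
  have -> : tperm x y = (tperm x (widen_ord (leqnSn n) i) ^ simple i)%g.
    rewrite tpermJ tpermL tpermD //.
    - by congr tperm.
    - by rewrite -val_eqE /= -[X in _ != X]addn0 eqn_add2l -lt0n.
    - by rewrite -Dyi -val_eqE /= Dy -[X in _ != X]addn0 eqn_add2l.
  by rewrite groupJ.
have sH : s \in H.
  have [ts -> _] := prod_tpermP s.
  apply: group_prod => t _.
  have [le12 | /ltnW le21] := leqP t.1 t.2.
    by apply: (tpermH (t.2 - t.1)); rewrite subnKC.
  by rewrite tpermC; apply: (tpermH (t.1 - t.2)); rewrite subnKC.
have [k [c cP ->]] := gen_prodgP sH.
have fP j : exists i, c j == simple i.
  by have /imsetP[i _ ->] := cP j; exists i.
exists k; apply/existsP; exists [tuple xchoose (fP j) | j < k].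
rewrite big_tuple; apply/eqP; apply: eq_bigr => j _.
by rewrite tnth_mktuple; apply/eqP/(xchooseP (fP j)).
Qed.

Definition ell (n : nat) (s : 'S_n.+1) : nat := ex_minn (ex_word s).

Definition DesL (n : nat) (s : 'S_n.+1) : {set 'I_n} :=
  [set i | ell (pcomp (simple i) s) < ell s].

Definition DesR (n : nat) (s : 'S_n.+1) : {set 'I_n} :=
  [set i | ell (pcomp s (simple i)) < ell s].

Definition coverL (n : nat) : rel 'S_n.+1 :=
  fun s t => [exists i, (i \notin DesL s) && (t == pcomp (simple i) s)].

Definition coverR (n : nat) : rel 'S_n.+1 :=
  fun s t => [exists i, (i \notin DesR s) && (t == pcomp s (simple i))].

Definition leL (n : nat) : rel 'S_n.+1 := connect (@coverL n).
Definition leR (n : nat) : rel 'S_n.+1 := connect (@coverR n).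

Definition intervalL (n : nat) (s r : 'S_n.+1) : {set 'S_n.+1} :=
  [set g | leL s g && leL g r].

Definition w0 (n : nat) (A : {set 'I_n}) : 'S_n.+1 :=
  [arg max_(w > 1%g in <<[set simple i | i in A]>>%g) ell w].

Definition w1 (n : nat) (A : {set 'I_n}) : 'S_n.+1 :=
  pcomp (w0 setT) (w0 (~: A)).

(* For a composition a of n.+1. *)
Definition set_of_comp (n : nat) (a : seq nat) : {set 'I_n} :=
  [set i : 'I_n |
    [exists k : 'I_(size a), (0 < k) && (i.+1 == sumn (take k a))]].

Definition poset_iso (T U : finType) (leT : rel T) (A : {set T})
    (leU : rel U) (B : {set U}) (f : T -> U) : bool :=
  [&& dinjectiveb f (mem A), f @: A == B
    & [forall x in A, forall y in A, leU (f x) (f y) == leT x y]].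

Definition Int (n : nat) : {set {set 'S_n.+1}} :=
  [set I | [exists s, exists r, (I == intervalL s r) && (I != set0)]].

Definition simD (n : nat) (I1 I2 : {set 'S_n.+1}) : bool :=
  [exists f : {ffun 'S_n.+1 -> 'S_n.+1},
     poset_iso (@leL n) I1 (@leL n) I2 f
     && [forall g in I1, DesL (f g) == DesL g]].

Definition classD (n : nat) (I : {set 'S_n.+1}) : {set {set 'S_n.+1}} :=
  [set J in Int n | simD I J].

(* The endpoints of a nonempty interval are determined by the interval. *)
Definition leInt (n : nat) : rel {set 'S_n.+1} := fun I J =>
  [exists s, exists r, exists s', exists r',
    [&& leL s r, leL s' r', I == intervalL s r, J == intervalL s' r'
      & leR s s']].

Definition is_min (T : finType) (le : rel T) (C : {set T}) (m : T) : Prop :=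
  m \in C /\ {in C, forall x, le m x}.

Definition is_max (T : finType) (le : rel T) (C : {set T}) (m : T) : Prop :=
  m \in C /\ {in C, forall x, le x m}.

(* A diagram has n.+1 boxes and no empty row or column, hence fits in a square
   of side n.+1. Definitions are made for every set of boxes in that square. *)
Notation box n := ('I_n.+1 * 'I_n.+1)%type.
Notation diagram n := {set box n}.
Notation boxes D := {b | b \in D}.

(* As no row or column is empty, their number is the largest coordinate. *)
Definition nrows (n : nat) (D : diagram n) : nat := \max_(b in D) b.2.+1.
Definition ncols (n : nat) (D : diagram n) : nat := \max_(b in D) b.1.+1.

Definition row_comp (n : nat) (D : diagram n) : seq nat :=
  rev [seq #|[set b in D | b.2 == y :> nat]| | y <- iota 0 (nrows D)].

Definition col_comp (n : nat) (D : diagram n) : seq nat :=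
  [seq #|[set b in D | b.1 == x :> nat]| | x <- iota 0 (ncols D)].

Definition free_upper_right (n : nat) (D : diagram n) : bool :=
  ~~ [exists b in D, exists c in D,
       [&& b.1 < c.1, b.2 < c.2 &
         [forall d in D, (b.1 <= d.1 <= c.1) && (b.2 <= d.2 <= c.2)
                           ==> (d == b) || (d == c)]]].

Definition reflx_box (n : nat) (D : diagram n) (b : box n) : box n :=
  (b.1, inord ((nrows D).-1 - b.2)).

Definition reflx (n : nat) (D : diagram n) : diagram n := reflx_box D @: D.

Lemma reflx_box_mem (n : nat) (D : diagram n) (b : box n) :
  b \in reflx D -> reflx_box D b \in D.
Proof.
case/imsetP=> -[x y] Dxy ->.
have lty : y < nrows D by apply: (leq_bigmax_cond (x, y) Dxy).
suff -> : reflx_box D (reflx_box D (x, y)) = (x, y) by [].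
have lt_n k : (nrows D).-1 - k < n.+1.
  apply: leq_ltn_trans (leq_subr _ _) _.
  rewrite prednK ?(leq_ltn_trans _ lty) //.
  by apply/bigmax_leqP => c _; apply: ltn_ord.
congr (_, _); apply: val_inj; rewrite /= !inordK //.
by rewrite subKn // -ltnS prednK ?(leq_ltn_trans _ lty).
Qed.

Definition filling (n : nat) (D : diagram n) := {ffun boxes D -> 'I_n.+1}.

Definition std_filling (n : nat) (D : diagram n) (F : filling D) : bool :=
  injectiveb F && [forall k, k \in codom F].

Definition reflx_filling (n : nat) (D : diagram n) (F : filling D) :
    filling (reflx D) :=
  [ffun b : boxes (reflx D) =>
     F (exist _ (reflx_box D (val b)) (reflx_box_mem (valP b)))].

Definition P_ (n : nat) (D : diagram n) (F : filling D) : rel 'I_n.+1 :=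
  fun i j => [exists b : boxes D, exists c : boxes D,
    [&& F b == i, F c == j, (val b).1 <= (val c).1 & (val b).2 <= (val c).2]].

Definition SigmaL (n : nat) (P : rel 'I_n.+1) : {set 'S_n.+1} :=
  [set s : 'S_n.+1 | [forall i, forall j, P i j ==> (s i <= s j)]].

(* Columns from left to right, each read downwards, resp. upwards. *)
Definition down_cols (n : nat) : rel (box n) :=
  fun b c => (b.1 < c.1) || (b.1 == c.1) && (c.2 <= b.2).
Definition up_cols (n : nat) : rel (box n) :=
  fun b c => (b.1 < c.1) || (b.1 == c.1) && (b.2 <= c.2).

(* Rows read from left to right, top row first, resp. bottom row first. *)
Definition rows_top (n : nat) : rel (box n) :=
  fun b c => (c.2 < b.2) || (b.2 == c.2) && (b.1 <= c.1).
Definition rows_bot (n : nat) : rel (box n) :=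
  fun b c => (b.2 < c.2) || (b.2 == c.2) && (b.1 <= c.1).

Definition reading (n : nat) (r : rel (box n)) (D : diagram n) :
    seq (boxes D) :=
  sort (fun b c => r (val b) (val c)) (enum {: boxes D}).

(* The clamping done by [inord] never occurs when D has n.+1 boxes. *)
Definition fill (n : nat) (r : rel (box n)) (D : diagram n) : filling D :=
  [ffun b => inord (index b (reading r D))].

Definition F_down (n : nat) (D : diagram n) := fill (@down_cols n) D.
Definition F_right (n : nat) (D : diagram n) := fill (@rows_top n) D.
Definition T'_ (n : nat) (D : diagram n) := fill (@up_cols n) D.
Definition T_ (n : nat) (D : diagram n) := fill (@rows_bot n) D.

(* The permutation with the given one-line notation. The default value 1 is
   only used when the sequence is not such a notation, which cannot be the case
   for a reading word of a standard filling. *)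
Definition perm_of_word (n : nat) (w : seq 'I_n.+1) : 'S_n.+1 :=
  insubd (1%g : 'S_n.+1) [ffun k : 'I_n.+1 => nth ord0 w k].

Definition w_TL (n : nat) (D : diagram n) (F : filling D) : 'S_n.+1 :=
  perm_of_word [seq F b | b <- reading (@down_cols n) D].

Definition w_LT (n : nat) (D : diagram n) (F : filling D) : 'S_n.+1 :=
  perm_of_word [seq F b | b <- reading (@rows_top n) D].

Definition ST (n : nat) (D : diagram n) : {set filling D} :=
  [set T : filling D | std_filling T &&
    [forall b : boxes D, forall c : boxes D,
      ((val b).1 <= (val c).1) && ((val b).2 <= (val c).2) ==> (T b <= T c)]].

Definition leST (n : nat) (D : diagram n) : rel (filling D) :=
  fun T U => leL (w_TL T) (w_TL U).

(* For A = {z_1 < ... < z_p} (numbered from 1), [bounds A] is the sequence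
   z_0 = 0, z_1, ..., z_p, z_(p+1) = n.+1, and [block A i] is the interval of
   the integers k with z_i < k <= z_(i+1); it is empty for i > p. *)
Definition bounds (n : nat) (A : {set 'I_n}) : seq nat :=
  0 :: rcons [seq (val i).+1 | i <- enum A] n.+1.

Definition block (n : nat) (A : {set 'I_n}) (i : nat) : {set 'I_n.+1} :=
  [set k : 'I_n.+1 | nth 0 (bounds A) i <= k < nth 0 (bounds A) i.+1].

Definition D_set_perm (n : nat) (S : {set 'I_n}) (rho : 'S_n.+1) : diagram n :=
  [set b : box n |
    [set rho r | r in block (~: S) b.1] :&: block (DesL rho) b.2 != set0].

Definition D_perm_set (n : nat) (sigma : 'S_n.+1) (S : {set 'I_n}) : diagram n :=
  [set b : box n |
    [exists i : 'I_#|S|.+1, (b.2 == #|S| - i :> nat) &&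
      ([set sigma r | r in block S i] :&: block (~: DesL sigma) b.1 != set0)]].

(* Main.v *)
From mathcomp Require Import all_boot all_fingroup zify.
Require Import Defs.

(* The interval [w_0(S), rho] consists of the linear extensions of the product
   order on the boxes of D, each box being labelled by a position, so that
   labels increase along the order (<= in x, >= in y). An isomorphism that
   preserves left descents also preserves the colours of the covers, hence it is
   a right translation, that is, a relabelling of the boxes. The interval
   attached to another labelling g is equivalent to the first one when g
   compares in the same way any two boxes that can be adjacent in a linear
   extension of the product order. If D has no strictly upper-right
   configuration, two such boxes are comparable for (<= in x, >= in y), so every
   g that increases along this order qualifies. Conversely, inclusion of
   inversions and the descents at the two ends of the interval force g to
   increase: boxes next to each other in a column (row) have consecutive values
   at the bottom (top) of the interval. The labellings are thus the standard
   tableaux of the reflected diagram, compared by their inversions, and the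
   extreme ones read D by columns and by rows. The case of [sigma, w_1(S)] is
   the same, with the roles of rows and columns exchanged. *)

Set Implicit Arguments.
Unset Strict Implicit.
Unset Printing Implicit Defensive.

(** * Inversions and the weak orders *)

Section WeakOrder.
Variable n : nat.
Implicit Types (s t : 'S_n.+1) (i j : 'I_n) (a b k : 'I_n.+1).

Definition lo i : 'I_n.+1 := widen_ord (leqnSn n) i.
Definition hi i : 'I_n.+1 := lift ord0 i.

Lemma loE i : lo i = i :> nat. Proof. by []. Qed.
Lemma hiE i : hi i = i.+1 :> nat. Proof. by []. Qed.

Lemma eq_lo i k : (k == lo i) = (k == i :> nat). Proof. by []. Qed.
Lemma eq_hi i k : (k == hi i) = (k == i.+1 :> nat). Proof. by []. Qed.

Lemma simpleE i k :
  simple i k = (if k == i :> nat then i.+1 else if k == i.+1 :> nat then i : nat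
                else k) :> nat.
Proof.
rewrite /simple -/(lo i) -/(hi i); case: tpermP => [->|->|].
- by rewrite loE eqxx.
- by rewrite hiE eqxx; case: eqP => //; lia.
by move=> /eqP; rewrite eq_lo => /negPf -> /eqP; rewrite eq_hi => /negPf ->.
Qed.

Lemma simple_fix i k : k != i :> nat -> k != i.+1 :> nat -> simple i k = k.
Proof. by move=> /negPf ki /negPf ki1; apply: val_inj; rewrite /= simpleE ki ki1. Qed.

Lemma simpleK i : involutive (simple i).
Proof. exact: tpermK. Qed.

Lemma simple_lo i : simple i (lo i) = hi i. Proof. exact: tpermL. Qed.
Lemma simple_hi i : simple i (hi i) = lo i. Proof. exact: tpermR. Qed.

Lemma pcompE s t k : pcomp s t k = s (t k).
Proof. by rewrite /pcomp permM. Qed.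

(** Pairs of positions rather than of values: left multiplication by a simple transposition then
    adds or removes a single pair, and [leL] becomes inclusion. *)
Definition invs s : {set 'I_n.+1 * 'I_n.+1} :=
  [set p : 'I_n.+1 * 'I_n.+1 | (p.1 < p.2) && (s p.2 < s p.1)].

Lemma mem_invs s a b : ((a, b) \in invs s) = (a < b) && (s b < s a).
Proof. by rewrite inE. Qed.

Lemma perm_neq s a b : a < b -> s a != s b :> nat.
Proof. by move=> ab; rewrite val_eqE (inj_eq perm_inj) -val_eqE /= neq_ltn ab. Qed.

Lemma simple_lt i a b : (a, b) != (lo i, hi i) -> a < b -> simple i a < simple i b.
Proof.
rewrite xpair_eqE eq_lo eq_hi !simpleE.
by repeat case: ifP => /=; lia.
Qed.

(** Applying [simple i] to both entries carries the inversions of [s] onto those of the product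
    other than [(lo i, hi i)], which is new. *)
Lemma invs_simple s i : s (lo i) < s (hi i) ->
  #|invs (pcomp s (simple i))| = #|invs s|.+1.
Proof.
move=> lt_s; pose g (p : 'I_n.+1 * 'I_n.+1) := (simple i p.1, simple i p.2).
have gK : involutive g by case=> a b; rewrite /g /= !simpleK.
rewrite (cardsD1 (lo i, hi i)) mem_invs !pcompE simple_lo simple_hi lt_s hiE.
rewrite ltnSn add1n -(card_imset (invs s) (inv_inj gK)); congr _.+1.
apply: eq_card => -[a b]; rewrite in_setD1.
apply/andP/imsetP=> [[neq]|[[c d]]].
  rewrite mem_invs !pcompE => /andP[ab sab].
  exists (g (a, b)); last by rewrite gK.
  by rewrite inE /= sab simple_lt.
rewrite mem_invs => /andP[cd scd] [-> ->].
have neq: (c, d) != (lo i, hi i).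
  by apply: contraTneq scd => -[-> ->]; lia.
rewrite mem_invs simple_lt // !pcompE !simpleK scd; split=> //.
apply/eqP=> -[/(congr1 (simple i))]; rewrite simpleK simple_lo => Ec.
move=> /(congr1 (simple i)); rewrite simpleK simple_hi => Ed.
by move: cd; rewrite Ec Ed hiE loE; lia.
Qed.

Lemma pcompK s i : pcomp (pcomp s (simple i)) (simple i) = s.
Proof. by apply/permP=> k; rewrite !pcompE simpleK. Qed.

Lemma invs_simple_des s i : s (hi i) < s (lo i) ->
  #|invs s| = #|invs (pcomp s (simple i))|.+1.
Proof.
move=> lt_s; rewrite -(@invs_simple (pcomp s (simple i)) i) ?pcompK //.
by rewrite !pcompE simple_lo simple_hi.
Qed.

Lemma lo_or_hi s i : s (lo i) < s (hi i) \/ s (hi i) < s (lo i).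
Proof. have := @perm_neq s (lo i) (hi i); rewrite hiE ltnSn => /(_ isT); lia. Qed.

Lemma invs_le_word (w : seq 'I_n) : #|invs (\prod_(i <- w) simple i)%g| <= size w.
Proof.
elim: w => [|i w IH] /=.
  rewrite big_nil leqn0 cards_eq0; apply/eqP/setP=> -[a b].
  by rewrite mem_invs !perm1 in_set0; case: ltngtP.
rewrite big_cons; set s := (\prod_(_ <- _) _)%g in IH *.
have -> : (simple i * s)%g = pcomp s (simple i) by [].
have [h|h] := lo_or_hi s i; first by rewrite invs_simple.
by apply/leqW/ltnW; rewrite -invs_simple_des.
Qed.

Lemma card_ord_lt m : m <= n.+1 -> #|[set a : 'I_n.+1 | a < m]| = m.
Proof.
move=> le_m; rewrite -[RHS]card_ord.
have widen_inj : injective (widen_ord le_m).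
  by move=> c d /(congr1 val) /= cd; apply: val_inj.
rewrite -(card_imset 'I_m widen_inj); apply: eq_card => c; rewrite inE.
apply/idP/imsetP=> [lt_c|[d _ ->]]; last by rewrite /= ltn_ord.
by exists (Ordinal lt_c) => //; apply: val_inj.
Qed.

Lemma card_perm_lt s a : #|[set b | s b < s a]| = s a.
Proof.
rewrite -(card_imset _ (@perm_inj _ s)) -[RHS]card_ord_lt 1?ltnW ?ltn_ord //.
apply: eq_card => c; rewrite inE; apply/imsetP/idP=> [[b]|lt_c].
  by rewrite inE => lt_b ->.
by exists (s^-1 c)%g; rewrite ?inE ?permKV.
Qed.

(** The value of a permutation at [a] is the number of points with smaller value, so it is
    determined by the order of the values. *)
Lemma perm_lt_inj s t : (forall a b, s a < s b -> t a < t b) -> s = t.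
Proof.
move=> st.
apply/permP=> a; apply: val_inj; rewrite /= -[LHS]card_perm_lt -[RHS]card_perm_lt.
apply: eq_card => b; rewrite !inE.
apply/idP/idP => [|lt_t]; first exact: st.
have [//|lt_s|eq_s] := ltngtP (s b) (s a).
  by have := st _ _ lt_s; lia.
by move: lt_t; rewrite (perm_inj (val_inj eq_s)); lia.
Qed.

Lemma ord_ascending (f : 'I_n.+1 -> nat) a b : a < b ->
  (forall i, a <= i < b -> f (lo i) < f (hi i)) -> f a < f b.
Proof.
rewrite -(inord_val b); have := ltn_ord b.
elim: (val b) => [_|m IH lt_m]; first by rewrite inordK.
pose i : 'I_n := Ordinal (lt_m : m < n).
have Em : inord m = lo i by apply: val_inj; rewrite /= inordK // ltnW.
have Em1 : inord m.+1 = hi i by apply: val_inj; rewrite /= inordK.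
rewrite inordK // ltnS => le_am f_lt.
have fi : f (inord m) < f (inord m.+1).
  by rewrite Em Em1; apply: f_lt; rewrite le_am /= ltnSn.
move: le_am; rewrite leq_eqVlt => /orP[/eqP am|lt_am].
  by rewrite -{1}(inord_val a) am.
apply: ltn_trans fi; apply: IH; rewrite ?inordK ?(ltnW lt_m) //.
by move=> j /andP[le_aj lt_jm]; apply: f_lt; rewrite le_aj ltnW.
Qed.

Lemma ord_descending (f : 'I_n.+1 -> 'I_n.+1) a b : a < b ->
  (forall i, a <= i < b -> f (hi i) < f (lo i)) -> f b < f a.
Proof.
move=> ab f_lt; suff: n.+1 - f a < n.+1 - f b by lia.
apply: (ord_ascending (f := fun k => n.+1 - f k) ab) => i /f_lt.
by have := ltn_ord (f (lo i)); lia.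
Qed.

Lemma ascending_id s : (forall i, s (lo i) < s (hi i)) -> s = 1%g.
Proof.
move=> s_lt; apply/esym/perm_lt_inj => a b; rewrite !perm1 => ab.
exact: (ord_ascending (f := fun k => s k)).
Qed.

(** Sorting: composing with [simple i] at a descent [i] removes exactly one inversion, and only the
    identity has no descent. *)
Lemma has_word_invs s : has_word s #|invs s|.
Proof.
have [m] := ubnP #|invs s|; elim: m s => // m IH s lt_m.
have [asc|] := boolP [forall i, s (lo i) < s (hi i)].
  have -> : s = 1%g by apply: ascending_id; apply/forallP.
  have -> : #|invs 1| = 0.
    by apply/eqP; rewrite -leqn0; have := invs_le_word [::]; rewrite big_nil.
  by apply/existsP; exists [tuple]; rewrite big_nil.
rewrite negb_forall => /existsP[i]; rewrite -leqNgt => le_s.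
have lt_s : s (hi i) < s (lo i) by have [] := lo_or_hi s i; lia.
have card_s := invs_simple_des lt_s.
set s' := pcomp s (simple i) in card_s.
have /existsP[w /eqP Dw] : has_word s' #|invs s'| by apply: IH; lia.
apply/existsP; rewrite card_s; exists [tuple of i :: w].
by rewrite big_cons -Dw; apply/eqP; rewrite -{1}(pcompK s i).
Qed.

(** Each letter of a word changes the number of inversions by one, so no word is shorter than this
    number, and sorting attains it. *)
Lemma ellE s : ell s = #|invs s|.
Proof.
rewrite /ell; case: ex_minnP => m /existsP[w /eqP Dw] min_m; apply/eqP.
rewrite eqn_leq min_m ?has_word_invs // Dw.
by have := invs_le_word w; rewrite size_tuple.
Qed.

Lemma mem_DesR s i : (i \in DesR s) = (s (hi i) < s (lo i)).
Proof.
rewrite inE !ellE; have [lt_s|lt_s] := lo_or_hi s i.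
  by rewrite invs_simple //; lia.
by rewrite (invs_simple_des lt_s); lia.
Qed.

Lemma card_invsV s : #|invs s^-1| = #|invs s|.
Proof.
pose g (p : 'I_n.+1 * 'I_n.+1) := (s p.2, s p.1).
have g_inj : injective g by case=> a b [c d] [] /perm_inj -> /perm_inj ->.
rewrite -(card_imset (invs s) g_inj); apply: eq_card => -[a b].
apply/idP/imsetP => [|[[c d]]]; rewrite mem_invs.
  move=> /andP[lt_ab lt_s]; exists (s^-1 b, s^-1 a)%g.
    by rewrite mem_invs !permKV lt_s.
  by rewrite /g /= !permKV.
by move=> /andP[lt_cd lt_s] [-> ->]; rewrite mem_invs !permK lt_cd lt_s.
Qed.

Lemma simpleV i : (simple i)^-1%g = simple i.
Proof. exact: tpermV. Qed.

Lemma pcompV s t : ((pcomp s t)^-1 = pcomp t^-1 s^-1)%g.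
Proof. exact: invMg. Qed.

Lemma DesLV s : DesL s = DesR s^-1%g.
Proof.
apply/setP=> i; rewrite !inE !ellE -(card_invsV (pcomp _ _)) pcompV simpleV.
by rewrite card_invsV.
Qed.

Lemma mem_DesL s i : (i \in DesL s) = (s^-1%g (hi i) < s^-1%g (lo i)).
Proof. by rewrite DesLV mem_DesR. Qed.

Lemma notin_DesL s i : (i \notin DesL s) = (s^-1%g (lo i) < s^-1%g (hi i)).
Proof. by rewrite mem_DesL; case: (lo_or_hi s^-1 i); lia. Qed.

Lemma coverL_ell s t : coverL s t -> ell t = (ell s).+1.
Proof.
case/existsP=> i /andP[]; rewrite notin_DesL => lt_s /eqP ->.
rewrite !ellE -(card_invsV (pcomp _ _)) pcompV simpleV invs_simple //.
by rewrite card_invsV.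
Qed.

Lemma coverL_invs s t : coverL s t -> invs s \subset invs t.
Proof.
case/existsP=> i /andP[]; rewrite notin_DesL => lt_s /eqP ->.
apply/subsetP=> -[a b]; rewrite !mem_invs !pcompE => /andP[lt_ab lt_ba].
rewrite lt_ab; apply: simple_lt => //; apply/eqP=> -[Db Da].
by move: lt_s; rewrite -Db -Da !permK ltnNge ltnW.
Qed.

(** Covers add inversions. Conversely, by induction on the number of inversions of [t] missing in
    [s], some cover of [s] is still below [t]. *)
Lemma leL_invs s t : leL s t = (invs s \subset invs t).
Proof.
apply/idP/idP=> [/connectP[p]|].
  elim: p s => [|u p IH] s /=; first by move=> _ ->.
  by case/andP=> /coverL_invs su pu tu; apply: subset_trans su (IH _ pu tu).
have [m] := ubnP (#|invs t| - #|invs s|); elim: m s => // m IH s lt_m le_st.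
have lt_st a b : a < b -> s b < s a -> t b < t a.
  move=> lt_ab lt_s; have : (a, b) \in invs t.
    by apply: (subsetP le_st); rewrite mem_invs lt_ab.
  by rewrite mem_invs => /andP[].
(* Without a descent the quotient of [t] by [s] is the identity. At a descent [i], the positions
   where [s] takes the values [i] and [i.+1] are inverted by [t] but not by [s]. *)
have [asc|] := boolP [forall i, pcomp t s^-1 (lo i) < pcomp t s^-1 (hi i)].
  have : pcomp t s^-1 = 1%g by apply: ascending_id; apply/forallP.
  rewrite /pcomp => /(canRL (mulKVg _)); rewrite mulg1 => ->.
  exact: connect0.
rewrite negb_forall => /existsP[i]; rewrite -leqNgt !pcompE => le_t.
have {le_t} lt_t : t (s^-1 (hi i))%g < t (s^-1 (lo i))%g.
  by case: (lo_or_hi (pcomp t s^-1) i); rewrite !pcompE //; lia.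
have asc_s : (s^-1 (lo i))%g < (s^-1 (hi i))%g.
  case: (lo_or_hi s^-1 i) => // lt_s.
  suff: t (s^-1 (lo i))%g < t (s^-1 (hi i))%g by lia.
  by apply: lt_st => //; rewrite !permKV hiE.
have cov_s : coverL s (pcomp (simple i) s).
  by apply/existsP; exists i; rewrite notin_DesL asc_s eqxx.
(* The only inversion gained by the cover is this pair of positions, and [t] has it too. *)
have le_t : invs (pcomp (simple i) s) \subset invs t.
  apply/subsetP=> -[a b]; rewrite !mem_invs !pcompE => /andP[lt_ab lt_s].
  rewrite lt_ab /=; have [lt_s'|] := ltnP (s b) (s a); first exact: lt_st.
  rewrite leq_eqVlt => /orP[/eqP/val_inj/perm_inj|lt_s'].
    by move: lt_ab => /[swap] ->; rewrite ltnn.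
  have [[Da Db]|neq] := eqVneq (s a, s b) (lo i, hi i).
    by move: lt_t; rewrite -Da -Db !permK.
  by have := simple_lt neq lt_s'; lia.
apply: connect_trans (connect1 cov_s) (IH _ _ le_t).
have := coverL_ell cov_s; rewrite !ellE => Ds.
by have := subset_leq_card le_t; lia.
Qed.

Lemma leLP s t :
  reflect (forall a b, a < b -> s b < s a -> t b < t a) (leL s t).
Proof.
rewrite leL_invs; apply: (iffP subsetP) => [st a b ab s_ba|st [a b]].
  by have := st (a, b); rewrite !mem_invs ab s_ba => /(_ isT).
by rewrite !mem_invs => /andP[ab s_ba]; rewrite ab st.
Qed.

Lemma leL_refl s : leL s s. Proof. exact: connect0. Qed.
Lemma leL_trans s t u : leL s t -> leL t u -> leL s u.
Proof. exact: connect_trans. Qed.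

Lemma leL_anti s t : leL s t -> leL t s -> s = t.
Proof.
move=> /leLP st /leLP ts; apply: perm_lt_inj => a b s_ab.
have [ab|ba|/val_inj eq_ab] := ltngtP a b.
- have [//|t_ba|/val_inj/perm_inj eq_ab] := ltngtP (t a) (t b).
    by have := ts _ _ ab t_ba; lia.
  by move: ab; rewrite eq_ab ltnn.
- exact: st.
- by move: s_ab; rewrite eq_ab ltnn.
Qed.

Lemma leL_ell s t : leL s t -> ell s <= ell t.
Proof. by rewrite leL_invs !ellE; apply: subset_leq_card. Qed.

Lemma leL_ell_eq s t : leL s t -> ell t <= ell s -> s = t.
Proof.
rewrite leL_invs => st; rewrite !ellE => le_ts.
have /eqP Dst : invs s == invs t by rewrite eqEcard st.
by apply: leL_anti; rewrite leL_invs Dst.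
Qed.

(** Taking inverses exchanges left and right multiplication, hence the covers of the two orders. *)
Lemma leRE s t : leR s t = leL s^-1%g t^-1%g.
Proof.
have cov (u v : 'S_n.+1) : coverR u v = coverL u^-1%g v^-1%g.
  apply: eq_existsb => i; rewrite DesLV invgK; congr (_ && _).
  by rewrite -(inj_eq invg_inj) pcompV simpleV.
apply/idP/idP=> /connectP[p].
  elim: p s => [|u p IH] s /=; first by move=> _ ->; apply: leL_refl.
  case/andP; rewrite cov => su pu tu.
  exact: leL_trans (connect1 su) (IH _ pu tu).
elim: p s => [|u p IH] s /=; first by move=> _ /invg_inj ->; apply: connect0.
case/andP=> su pu tu; apply: (@connect_trans _ _ u^-1%g).
  by apply: connect1; rewrite cov invgK.
by apply: IH; rewrite ?invgK.
Qed.

End WeakOrder.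

(** * Blocks and longest elements *)

Section Blocks.
Variable n : nat.
Implicit Types (s t : 'S_n.+1) (i j : 'I_n) (a b k : 'I_n.+1) (A : {set 'I_n}).

(* The index of the block of [A] that contains [k]. *)
Definition bidx A (k : nat) : nat := #|[set i in A | i < k]|.

Lemma bidx_mono A a b : a <= b -> bidx A a <= bidx A b.
Proof.
move=> ab; apply/subset_leq_card/subsetP=> i.
by rewrite !inE => /andP[->] /= /leq_trans->.
Qed.

Lemma bidx_eq A a b : a <= b ->
  (bidx A a == bidx A b) = [forall i : 'I_n, (a <= i < b) ==> (i \notin A)].
Proof.
move=> ab; set Sa := [set i in A | i < a]; set Sb := [set i in A | i < b].
have sub : Sa \subset Sb.
  by apply/subsetP=> i; rewrite !inE => /andP[->] /= /leq_trans->.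
rewrite /bidx -/Sa -/Sb; apply/eqP/forallP=> [eq_c i|noA].
  have /eqP eqS : Sa == Sb by rewrite eqEcard sub eq_c leqnn.
  apply/implyP=> /andP[le_ai lt_ib]; apply/negP=> iA.
  have : i \in Sb by rewrite inE iA lt_ib.
  by rewrite -eqS inE ltnNge le_ai andbF.
congr #|pred_of_set _|; apply/eqP; rewrite eqEsubset sub.
apply/subsetP=> i; rewrite !inE => /andP[iA lt_ib]; rewrite iA ltnNge.
by apply/negP=> le_ai; have := noA i; rewrite le_ai lt_ib iA.
Qed.

(** In a strictly increasing list the entries at most [m] form a prefix, whose length is their
    number. *)
Lemma sorted_count (w : seq nat) (m p : nat) : sorted ltn w -> p < size w ->
  (nth 0 w p <= m) = (p < count (fun z => z <= m) w).
Proof.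
elim: w p => // x w IH p /= path_xw lt_p.
have [le_xm|lt_mx] := leqP x m.
  by case: p lt_p => //= p lt_p; rewrite IH ?(path_sorted path_xw).
have lt_w (z : nat) : z \in w -> x < z.
  by move/allP: (order_path_min ltn_trans path_xw); apply.
have -> : count (fun z => z <= m) w = 0.
  apply/eqP; rewrite -leqn0 leqNgt -has_count; apply/hasPn=> z /lt_w; lia.
case: p lt_p => [|p] /= lt_p; first lia.
have lt_x : x < nth 0 w p := lt_w _ (mem_nth 0 lt_p); lia.
Qed.

Lemma bounds_sorted A : sorted ltn (bounds A).
Proof.
set w := [seq (val i).+1 | i <- enum A].
have sorted_w : sorted ltn w.
  rewrite sorted_map /enum_mem; apply: sorted_filter.
    by move=> j i k /=; lia.
  rewrite -enumT; suff: sorted ltn (map val (enum 'I_n)) by rewrite sorted_map.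
  by rewrite val_enum_ord iota_ltn_sorted.
have pos : all (leq 1) (rcons w n.+1).
  by rewrite all_rcons /=; apply/allP=> _ /mapP[i _ ->].
have lt_w (z : nat) : z \in w -> z < n.+1.
  by case/mapP=> i _ ->; rewrite ltnS ltn_ord.
have sorted_r : sorted ltn (rcons w n.+1).
  case: (w) sorted_w lt_w => //= x u path_xu lt_u.
  by rewrite rcons_path path_xu /= lt_u // mem_last.
rewrite /bounds /=; case: (rcons _ _) pos sorted_r => //= x u.
by case/andP=> -> _ ->.
Qed.

(** Links the blocks cut out by [bounds], used by the diagrams, with the counting function
    [bidx]. *)
Lemma mem_block A k (p : nat) : (k \in block A p) = (p == bidx A k).
Proof.
have sz : size (bounds A) = #|A|.+2 by rewrite /= size_rcons size_map -cardE.
(* The successor accounts for the leading bound 0; the last bound [n.+1] is never counted. *)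
have cnt : count (fun z => z <= k) (bounds A) = (bidx A k).+1.
  rewrite /= -cats1 count_cat /= leqNgt ltn_ord add1n !addn0; congr _.+1.
  rewrite count_map /bidx cardE /enum_mem -size_filter -filter_predI.
  by congr size; apply: eq_filter => i; rewrite /= inE andbC.
have le_b : bidx A k <= #|A|.
  by apply/subset_leq_card/subsetP=> i; rewrite inE => /andP[].
rewrite inE; have [lt_p|] := ltnP p.+1 (size (bounds A)).
  rewrite ltnNge !sorted_count ?bounds_sorted ?(ltnW lt_p) // cnt; lia.
(* Past the last bound [nth] returns 0, so the block is empty, while [bidx] never exceeds the
   cardinal of [A]. *)
move=> le_p; rewrite [X in _ && (_ < X)]nth_default // ltn0 andbF; lia.
Qed.

Lemma bidx_le A k : bidx A k <= #|A|.
Proof. by apply/subset_leq_card/subsetP=> i; rewrite inE => /andP[]. Qed.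

Notation parabolic A := <<[set simple i | i in A]>>%g.

(** A generator other than [simple i] moves nothing across the gap between [i] and [i.+1], and the
    permutations with this property form a group. *)
Lemma parabolic_stable A s i a : s \in parabolic A -> i \notin A ->
  (s a <= i) = (a <= i).
Proof.
move=> + iA.
suff: s \in parabolic A -> [forall a : 'I_n.+1, (s a <= i) == (a <= i)].
  by move=> h /h /forallP/(_ a)/eqP.
pose H := [set s : 'S_n.+1 | [forall a : 'I_n.+1, (s a <= i) == (a <= i)]].
have gH : group_set H.
  apply/group_setP; split=> [|u v]; rewrite !inE.
    by apply/forallP=> k; rewrite perm1.
  move=> /forallP hu /forallP hv; apply/forallP=> k.
  by rewrite permM (eqP (hv _)) (eqP (hu _)).
suff sub : parabolic A \subset Group gH by move/(subsetP sub); rewrite inE.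
rewrite gen_subG; apply/subsetP=> _ /imsetP[j jA ->]; rewrite inE.
apply/forallP=> k; rewrite simpleE.
have : i != j by apply: contraNneq iA => ->.
rewrite -val_eqE /= => neq_ij; apply/eqP.
by repeat case: eqP => //; lia.
Qed.

Lemma w0_max A : w0 A \in parabolic A /\
  forall s, s \in parabolic A -> ell s <= ell (w0 A).
Proof. by rewrite /w0; case: arg_maxnP => //=; rewrite group1. Qed.

(* Multiplying the longest element by a simple generator of the parabolic
   subgroup cannot lengthen it, so it descends at every generator. *)
Lemma w0_inv A a b : a < b ->
  (w0 A b < w0 A a) = (bidx (~: A) a == bidx (~: A) b).
Proof.
move=> ab; move: (w0 A) (w0_max A) => w [wA max_w].
rewrite (bidx_eq _ (ltnW ab)); apply/idP/forallP=> [lt_w i|].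
  apply/implyP=> /andP[le_ai lt_ib]; rewrite inE negbK; apply/negPn/negP=> iA.
  have := parabolic_stable a wA iA; have := parabolic_stable b wA iA; lia.
have des i : i \in A -> w (hi i) < w (lo i).
  move=> iA; have [lt_w|//] := lo_or_hi w i.
  have siA : pcomp w (simple i) \in parabolic A.
    by rewrite groupM // mem_gen // imset_f.
  by have := max_w _ siA; rewrite !ellE invs_simple // ltnn.
move=> inA; apply: ord_descending ab _ => i i_ab; apply: des.
by have := inA i; rewrite i_ab in_setC negbK.
Qed.

Lemma w0T_lt (c d : 'I_n.+1) : c < d -> w0 setT d < w0 setT c.
Proof.
move=> cd; rewrite (w0_inv _ cd) (bidx_eq _ (ltnW cd)).
by apply/forallP=> i; rewrite setCT inE implybT.
Qed.

(** The longest element [w0 setT] reverses the order of values, so the inversions of [w1 A] are the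
    non-inversions of [w0 (~: A)]. *)
Lemma w1_inv A a b : a < b -> (w1 A b < w1 A a) = (bidx A a != bidx A b).
Proof.
move=> ab; rewrite /w1 !pcompE -[in RHS](setCK A) -(w0_inv _ ab).
move: (w0 setT) w0T_lt (w0 (~: A)) => u u_lt v.
have lt_u c d : (u d < u c) = (c < d).
  have [/u_lt //|/u_lt|/val_inj ->] := ltngtP c d; last by rewrite ltnn.
  by move=> lt_dc; rewrite ltnNge ltnW.
by rewrite lt_u; case: ltngtP (perm_neq v ab) => //= ->; rewrite eqxx.
Qed.

End Blocks.

(** * Descent-preserving isomorphisms of intervals *)

Section Isomorphisms.
Variable n : nat.
Implicit Types (s t u v : 'S_n.+1) (i j : 'I_n) (a b k : 'I_n.+1).

Lemma mem_intervalL s t u : (u \in intervalL s t) = leL s u && leL u t.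
Proof. by rewrite inE. Qed.

(** If [i] and [j] are adjacent indices, the three values concerned stand in increasing positions in
    [u], and exchanging two of them cannot invert the other adjacent pair; if they are farther
    apart, the pair of [j] is untouched. *)
Lemma DesL_simple u i j : i \notin DesL u -> j \notin DesL u ->
  j \in DesL (pcomp (simple i) u) -> i = j.
Proof.
rewrite !notin_DesL mem_DesL pcompV simpleV !pcompE => lt_i lt_j.
have [Dj|neq_ji] := eqVneq (j : nat) i.+1.
  have -> : simple i (hi j) = hi j by apply: simple_fix; rewrite hiE; lia.
  have Elo : lo j = hi i by apply: val_inj.
  by rewrite Elo simple_hi; move: lt_j; rewrite Elo; lia.
have [Di|neq_ij] := eqVneq (i : nat) j.+1.
  have -> : simple i (lo j) = lo j by apply: simple_fix; rewrite loE; lia.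
  have Ehi : hi j = lo i by apply: val_inj.
  by rewrite Ehi simple_lo; move: lt_j; rewrite Ehi; lia.
have [/val_inj //|neq] := eqVneq (i : nat) j.
have -> : simple i (lo j) = lo j by apply: simple_fix; rewrite loE; lia.
have -> : simple i (hi j) = hi j by apply: simple_fix; rewrite hiE; lia.
lia.
Qed.

Section Iso.
Variables (s t s' t' : 'S_n.+1) (f : 'S_n.+1 -> 'S_n.+1).
Hypotheses (le_st : leL s t) (le_st' : leL s' t').
Hypothesis isoP :
  poset_iso (@leL n) (intervalL s t) (@leL n) (intervalL s' t') f.
Hypothesis desP : {in intervalL s t, forall u, DesL (f u) = DesL u}.

Let f_im u : u \in intervalL s t -> f u \in intervalL s' t'.
Proof. by case/and3P: isoP => _ /eqP <- _ ?; apply: imset_f. Qed.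

Let f_surj v : v \in intervalL s' t' -> exists2 u, u \in intervalL s t & f u = v.
Proof.
by case/and3P: isoP => _ /eqP <- _ /imsetP[u ? ->]; exists u.
Qed.

Let f_le : {in intervalL s t &, forall u v, leL (f u) (f v) = leL u v}.
Proof.
case/and3P: isoP => _ _ /forall_inP f_le u v uI vI.
exact/eqP/(forall_inP (f_le u uI)).
Qed.

Let s_in : s \in intervalL s t.
Proof. by rewrite mem_intervalL leL_refl. Qed.

Lemma iso_bottom : f s = s'.
Proof.
have [|u uI fu] := @f_surj s'; first by rewrite mem_intervalL leL_refl.
apply: leL_anti; last by have := f_im s_in; rewrite mem_intervalL => /andP[].
by rewrite -fu f_le //; move: uI; rewrite mem_intervalL => /andP[].
Qed.

Lemma iso_top : f t = t'.
Proof.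
have t_in : t \in intervalL s t by rewrite mem_intervalL le_st leL_refl.
have [|u uI fu] := @f_surj t'; first by rewrite mem_intervalL le_st' leL_refl.
apply: leL_anti; first by have := f_im t_in; rewrite mem_intervalL => /andP[].
by rewrite -fu f_le //; move: uI; rewrite mem_intervalL => /andP[].
Qed.

(* A cover [u < s_i u] is sent to a cover [f u < s_j (f u)]; both i and j are
   new left descents, and a cover creates only one. *)
Lemma iso_cover u v i : u \in intervalL s t -> v \in intervalL s t ->
  i \notin DesL u -> v = pcomp (simple i) u -> f v = pcomp (simple i) (f u).
Proof.
move=> uI vI iu Dv.
have cov : coverL u v by apply/existsP; exists i; rewrite iu Dv eqxx.
have le_uv : leL u v := connect1 cov.
have := le_uv; rewrite -(f_le uI vI) => le_f.
have [[|w p] /=] := connectP le_f.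
  move=> _ Df; have : leL v u by rewrite -(f_le vI uI) Df leL_refl.
  by move/leL_ell; rewrite (coverL_ell cov) ltnn.
(* The first element of a chain from [f u] to [f v] has a preimage between [u] and [v]; as [v]
   covers [u], this preimage is [v]. *)
case/andP=> cov_w path_p Df.
have le_w : leL w (f v) by apply/connectP; exists p.
have [|u1 u1I fu1] := @f_surj w.
  have := f_im uI; have := f_im vI; rewrite !mem_intervalL.
  move=> /andP[_ le_vt] /andP[le_su _].
  by rewrite (leL_trans le_su (connect1 cov_w)) (leL_trans le_w le_vt).
have le_u1 : leL u u1 by rewrite -(f_le uI u1I) fu1; apply: connect1.
have le_u1v : leL u1 v by rewrite -(f_le u1I vI) fu1.
have Du1 : u1 = v.
  apply: leL_ell_eq => //; rewrite (coverL_ell cov) ltnNge; apply/negP=> le_ell.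
  have := coverL_ell cov_w; rewrite -fu1 (leL_ell_eq le_u1 le_ell).
  by move/eqP; rewrite eqn_leq ltnn andbF.
have [j /andP[jfu /eqP Dw]] := existsP cov_w.
suff -> : i = j by rewrite -Du1 fu1.
apply: (DesL_simple iu); first by rewrite -(desP uI).
rewrite -Dv -(desP vI) -Du1 fu1 Dw mem_DesL pcompV simpleV !pcompE.
by rewrite simple_hi simple_lo -notin_DesL.
Qed.

(** Along a chain starting at [s], covers multiply an element and its image on the left by the same
    generator, so the right factor stays what it is at [s]. *)
Lemma iso_shift u : u \in intervalL s t -> f u = pcomp u (pcomp s^-1 s').
Proof.
rewrite mem_intervalL => /andP[/connectP[p path_p Du] le_ut].
have fs : f s = pcomp s (pcomp s^-1 s').
  by rewrite iso_bottom; apply/permP=> k; rewrite !pcompE permKV.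
suff gen w q : path (@coverL n) w q -> u = last w q -> w \in intervalL s t ->
    f w = pcomp w (pcomp s^-1 s') -> f u = pcomp u (pcomp s^-1 s').
  exact: gen path_p Du s_in fs.
elim: q w => [|v q IH] w /=; first by move=> _ ->.
case/andP=> cov path_q Du' wI fw.
have le_vu : leL v u by apply/connectP; exists q.
have vI : v \in intervalL s t.
  move: wI; rewrite !mem_intervalL => /andP[le_sw _].
  by rewrite (leL_trans le_sw (connect1 cov)) (leL_trans le_vu).
apply: (IH v) => //; have [i /andP[iw /eqP Dv]] := existsP cov.
by rewrite (iso_cover wI vI iw Dv) fw Dv; apply/permP=> k; rewrite !pcompE.
Qed.

End Iso.

Lemma intervalL_inj s t s' t' : leL s t -> leL s' t' ->
  intervalL s t = intervalL s' t' -> s = s' /\ t = t'.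
Proof.
move=> st st' /setP eqI.
have := eqI s; rewrite !mem_intervalL leL_refl st => /esym/andP[le_s's _].
have := eqI t; rewrite !mem_intervalL leL_refl st => /esym/andP[_ le_tt'].
have := eqI s'; rewrite !mem_intervalL leL_refl st' => /andP[le_ss' _].
have := eqI t'; rewrite !mem_intervalL leL_refl st' => /andP[_ le_t't].
by split; apply: leL_anti.
Qed.

End Isomorphisms.

(** * Intervals attached to labelled planar points *)

(* The points [(x k, y k)] are numbered column by column, upwards in each
   column; [tau] renumbers them row by row, bottom row first. *)
Section Points.
Variables (n : nat) (x y : 'I_n.+1 -> nat) (tau : 'S_n.+1).
Implicit Types (s t u v f g : 'S_n.+1) (i j : 'I_n) (a b k l m : 'I_n.+1).

Hypothesis lex_x : forall k l,
  (k < l) = (x k < x l) || (x k == x l) && (y k < y l).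
Hypothesis lex_y : forall k l,
  (tau k < tau l) = (y k < y l) || (y k == y l) && (x k < x l).
Hypothesis free : forall k l, x k < x l -> y k < y l ->
  exists m, [/\ m != k, m != l, x k <= x m <= x l & y k <= y m <= y l].

(* The point [k] carries the label [g k]. *)
Definition tableau g := forall k l, x k <= x l -> y l <= y k -> g k <= g l.
(** At the label of the point [k], the bottom takes the value [k], its rank by columns, and the top
    the value [tau k], its rank by rows. *)
Definition tab_interval g := intervalL g^-1%g (pcomp tau g^-1%g).

Lemma le_of_xy k l : x k <= x l -> y k <= y l -> k <= l.
Proof. by move=> xkl ykl; rewrite leqNgt lex_x; lia. Qed.

Lemma tau_le_of_xy k l : x k <= x l -> y k <= y l -> tau k <= tau l.
Proof. by move=> xkl ykl; rewrite leqNgt lex_y; lia. Qed.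

Lemma xy_inj k l : x k = x l -> y k = y l -> k = l.
Proof.
by move=> xkl ykl; apply: val_inj; apply/eqP; rewrite eqn_leq !le_of_xy ?xkl ?ykl.
Qed.

Lemma perm_ltn_neq s a b : a != b -> s a <= s b -> s a < s b.
Proof. by move=> ab; rewrite ltn_neqAle val_eqE (inj_eq perm_inj) ab. Qed.

(** Membership constrains [u] exactly on the pairs where both ends agree, which are the pairs
    comparable for [<=] in both coordinates. On any other pair the tableau condition makes the
    bottom non-inverted and the top inverted. *)
Lemma mem_tab_interval g u : tableau g ->
  reflect (forall k l, x k <= x l -> y k <= y l -> u (g k) <= u (g l))
    (u \in tab_interval g).
Proof.
move=> tab_g; rewrite mem_intervalL.
have -> : leL g^-1%g u =
    [forall k, forall l, (g k < g l) && (l < k) ==> (u (g l) < u (g k))].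
  apply/leLP/forallP=> [le_u k|le_u a b lt_ab lt_g].
    by apply/forallP=> l; apply/implyP=> /andP[? ?]; apply: le_u; rewrite ?permK.
  have /forallP/(_ (g^-1%g b))/implyP := le_u (g^-1%g a).
  by rewrite !permKV lt_ab; apply.
have -> : leL u (pcomp tau g^-1%g) =
    [forall k, forall l, (g k < g l) && (u (g l) < u (g k)) ==> (tau l < tau k)].
  apply/leLP/forallP=> [u_le k|u_le a b lt_ab lt_u].
    apply/forallP=> l; apply/implyP=> /andP[lt_g lt_u].
    by have := u_le _ _ lt_g lt_u; rewrite !pcompE !permK.
  have /forallP/(_ (g^-1%g b))/implyP := u_le (g^-1%g a); rewrite !pcompE !permKV.
  by rewrite lt_ab lt_u; apply.
apply: (iffP andP) => [[le_u u_le] k l xkl ykl|mono_u].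
  have [->|neq_kl] := eqVneq k l; first by [].
  have lt_kl : k < l by rewrite ltn_neqAle neq_kl le_of_xy.
  have lt_tau : tau k < tau l by apply: perm_ltn_neq; rewrite ?tau_le_of_xy.
  rewrite leqNgt; apply/negP=> lt_u.
  have [lt_g|lt_g|/val_inj/perm_inj eq_kl] := ltngtP (g k) (g l).
  - have /forallP/(_ l)/implyP := forallP u_le k.
    by rewrite lt_g lt_u => /(_ isT); lia.
  - have /forallP/(_ k)/implyP := forallP le_u l.
    by rewrite lt_g lt_kl => /(_ isT); lia.
  - by rewrite eq_kl eqxx in neq_kl.
have tabN k l : g k < g l -> (x l <= x k) && (y k <= y l) = false.
  by move=> lt_g; apply/negP=> /andP[xlk ykl]; have := tab_g _ _ xlk ykl; lia.
split; apply/forallP=> k; apply/forallP=> l; apply/implyP=> /andP[lt_g lt_kl].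
  apply: perm_ltn_neq; first by apply: contraTneq lt_g => ->; rewrite ltnn.
  have := tabN _ _ lt_g; move: lt_kl; rewrite lex_x => lt_lk h.
  by apply: mono_u; lia.
have := tabN _ _ lt_g.
have : (x k <= x l) && (y k <= y l) = false.
  by apply/negP=> /andP[xkl ykl]; have := mono_u _ _ xkl ykl; lia.
by rewrite lex_y; lia.
Qed.

Lemma tab_interval_le g : tableau g -> leL g^-1%g (pcomp tau g^-1%g).
Proof.
move=> tab_g; have : g^-1%g \in tab_interval g.
  by apply/mem_tab_interval => // k l xkl ykl; rewrite !permK le_of_xy.
by rewrite mem_intervalL => /andP[].
Qed.

Lemma tab_interval_inj f g : tableau f -> tableau g ->
  tab_interval f = tab_interval g -> f = g.
Proof.
move=> /tab_interval_le le_f /tab_interval_le le_g.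
by case/(intervalL_inj le_f le_g) => /invg_inj.
Qed.

Lemma tab_interval_Int g : tableau g -> tab_interval g \in Int n.
Proof.
move=> tab_g; rewrite inE; apply/existsP; exists g^-1%g; apply/existsP.
exists (pcomp tau g^-1%g); rewrite eqxx; apply/set0Pn; exists g^-1%g.
by rewrite mem_intervalL leL_refl tab_interval_le.
Qed.

(* Otherwise one point is strictly to the upper right of the other, and the
   value of [u] at a third point lies strictly between. *)
Lemma tab_adjacent f u k l i : tableau f -> u \in tab_interval f ->
  u (f k) = lo i -> u (f l) = hi i ->
  (x k <= x l) && (y l <= y k) || (x l <= x k) && (y k <= y l).
Proof.
move=> tab_f /(mem_tab_interval _ tab_f) mono_u uk ul.
have uf_inj : injective (u \o f) := inj_comp (@perm_inj _ u) (@perm_inj _ f).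
have : ~ (x k < x l /\ y k < y l).
  case=> xkl ykl; have [m [mk ml /andP[xkm xml] /andP[ykm yml]]] := free xkl ykl.
  have := mono_u _ _ xkm ykm; have := mono_u _ _ xml yml.
  rewrite uk ul loE hiE => le_mi1 le_im.
  have [Em|neq_mi] := eqVneq (u (f m) : nat) i.
    by move: mk; rewrite -(inj_eq uf_inj) /= uk -val_eqE /= Em eqxx.
  have [Em|neq_mi1] := eqVneq (u (f m) : nat) i.+1.
    by move: ml; rewrite -(inj_eq uf_inj) /= ul -val_eqE /= Em eqxx.
  lia.
have : ~ (x l <= x k /\ y l <= y k).
  by case=> xlk ylk; have := mono_u _ _ xlk ylk; rewrite uk ul loE hiE; lia.
lia.
Qed.

(** * Relabelling as a descent-preserving isomorphism *)

Definition relabel f g u := pcomp u (pcomp f g^-1%g).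

Lemma relabelE f g u k : relabel f g u (g k) = u (f k).
Proof. by rewrite !pcompE permK. Qed.

Lemma relabelK f g : cancel (relabel f g) (relabel g f).
Proof. by move=> u; apply/permP=> k; rewrite !pcompE !permK permKV. Qed.

Lemma relabel_mem f g u : tableau f -> tableau g ->
  u \in tab_interval f -> relabel f g u \in tab_interval g.
Proof.
move=> tab_f tab_g /(mem_tab_interval _ tab_f) mono_u.
by apply/mem_tab_interval => // k l xkl ykl; rewrite !relabelE mono_u.
Qed.

Lemma tab_lt f g k l : tableau f -> tableau g ->
  (x k <= x l) && (y l <= y k) || (x l <= x k) && (y k <= y l) ->
  (f k < f l) = (g k < g l).
Proof.
move=> tab_f tab_g; have [->|neq_kl] := eqVneq k l; first by rewrite !ltnn.
have lt_tab h k' l' : tableau h -> k' != l' -> x k' <= x l' -> y l' <= y k' ->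
    h k' < h l'.
  by move=> tab_h neq xkl ylk; apply: perm_ltn_neq; rewrite ?tab_h.
case/orP=> /andP[h1 h2]; first by rewrite !lt_tab.
have neq_lk : l != k by rewrite eq_sym.
rewrite ltnNge (ltnW (lt_tab f l k _ _ _ _)) //.
by rewrite ltnNge (ltnW (lt_tab g l k _ _ _ _)).
Qed.

(** Points with consecutive values under [u] are comparable for the tableau order by [tab_adjacent],
    so [f] and [g] order their labels alike. *)
Lemma relabel_DesL f g u : tableau f -> tableau g -> u \in tab_interval f ->
  DesL (relabel f g u) = DesL u.
Proof.
move=> tab_f tab_g uI; apply/setP=> i; rewrite !mem_DesL.
set k := f^-1%g (u^-1%g (lo i)); set l := f^-1%g (u^-1%g (hi i)).
have Ek : u (f k) = lo i by rewrite !permKV.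
have El : u (f l) = hi i by rewrite !permKV.
rewrite -{2}Ek -{2}El -{1}Ek -{1}El -!(relabelE f g) !permK.
rewrite !relabelE !permK; apply: tab_lt => //.
by have := tab_adjacent tab_f uI Ek El; lia.
Qed.

(** Pairs comparable for [<=] in both coordinates are ordered alike by [u] and [v]; all others are
    comparable for the tableau order, so their labels compare alike under [f] and [g]. *)
Lemma relabel_le f g u v : tableau f -> tableau g ->
  u \in tab_interval f -> v \in tab_interval f ->
  leL u v -> leL (relabel f g u) (relabel f g v).
Proof.
move=> tab_f tab_g /(mem_tab_interval _ tab_f) mono_u.
move=> /(mem_tab_interval _ tab_f) mono_v /leLP le_uv; apply/leLP=> a b.
rewrite -(permKV g a) -(permKV g b) !relabelE.
move: (g^-1%g a) (g^-1%g b) => k l lt_g lt_u.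
have [/andP[xlk ylk]|comp] := boolP ((x l <= x k) && (y l <= y k)).
  apply: perm_ltn_neq; last exact: mono_v.
  by rewrite (inj_eq perm_inj); apply: contraTneq lt_g => ->; rewrite ltnn.
have not_le : ~ (x k <= x l /\ y k <= y l).
  by case=> xkl ykl; have := mono_u _ _ xkl ykl; lia.
by apply: le_uv => //; rewrite (tab_lt (g := g)) //; lia.
Qed.

Lemma simD_tab f g : tableau f -> tableau g -> simD (tab_interval f) (tab_interval g).
Proof.
move=> tab_f tab_g; apply/existsP; exists [ffun u => relabel f g u].
apply/andP; split; last by apply/forall_inP=> u uI; rewrite ffunE relabel_DesL.
apply/and3P; split.
- by apply/dinjectiveP=> u v _ _; rewrite !ffunE => /(can_inj (@relabelK f g)).
- apply/eqP/setP=> v; apply/imsetP/idP=> [[u uI ->]|vI].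
    by rewrite ffunE relabel_mem.
  by exists (relabel g f v); rewrite ?relabel_mem // ffunE relabelK.
apply/forall_inP=> u uI; apply/forall_inP=> v vI; rewrite !ffunE; apply/eqP.
apply/idP/idP; last exact: relabel_le.
move=> le_r; rewrite -[u](relabelK f g) -[v](relabelK f g).
by apply: relabel_le => //; apply: relabel_mem.
Qed.

(* In the bottom element of the interval the points of a column carry
   consecutive values, and so do the points of a row in the top element;
   so preserving these two descent sets orders columns and rows. *)
Lemma tableau_of_Des f s t : tableau f -> leL s t -> t = pcomp tau s ->
  DesL s = DesL f^-1%g -> DesL t = DesL (pcomp tau f^-1%g) -> tableau s^-1%g.
Proof.
move=> tab_f /leLP le_st Dt Des_s Des_t k l xkl ylk.
have [->|neq_kl] := eqVneq k l; first by [].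
have neq_s : s^-1%g k != s^-1%g l by rewrite (inj_eq perm_inj).
have [x_eq|x_neq] := eqVneq (x k) (x l).
  have lt_lk : l < k.
    rewrite lex_x x_eq eqxx ltnn /= ltn_neqAle ylk andbT.
    by apply: contraNneq neq_kl => ykl; apply/eqP/xy_inj.
  (* The points numbered from [l] to [k] all lie in this column, each above the previous one, so the
     labels given by [f] decrease at each step. *)
  apply/ltnW/(ord_descending lt_lk) => i /andP[le_li lt_ik].
  rewrite -mem_DesL Des_s mem_DesL invgK.
  have h1 : lo i < hi i by rewrite loE hiE.
  have h2 : ~~ (lo i < l) by rewrite loE -leqNgt.
  have h3 : ~~ (k < hi i) by rewrite hiE -leqNgt.
  apply: perm_ltn_neq; first by apply: contraTneq h1 => ->; rewrite ltnn.
  by apply: tab_f; move: h1 h2 h3; rewrite !lex_x; lia.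
have [y_eq|y_neq] := eqVneq (y k) (y l).
  have lt_kl : tau k < tau l by rewrite lex_y y_eq eqxx /=; lia.
  suff : t^-1%g (tau k) < t^-1%g (tau l).
    by rewrite Dt pcompV !pcompE !permK => /ltnW.
  apply: (ord_ascending (f := fun a => t^-1%g a) lt_kl) => i /andP[le_ki lt_il].
  rewrite -notin_DesL Des_t notin_DesL pcompV invgK !pcompE.
  set p := tau^-1%g (lo i); set q := tau^-1%g (hi i).
  have Ep : tau p = lo i by rewrite permKV.
  have Eq : tau q = hi i by rewrite permKV.
  have h1 : tau p < tau q by rewrite Ep Eq loE hiE.
  have h2 : ~~ (tau p < tau k) by rewrite Ep loE -leqNgt.
  have h3 : ~~ (tau l < tau q) by rewrite Eq hiE -leqNgt.
  apply: perm_ltn_neq; first by apply: contraTneq h1 => ->; rewrite ltnn.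
  by apply: tab_f; move: h1 h2 h3; rewrite !lex_y; lia.
(* There remains [x k < x l] and [y l < y k]: an inversion of [s] at this pair would be one of [t],
   which contradicts [tau l < tau k]. *)
rewrite leqNgt; apply/negP=> lt_s.
have := le_st _ _ lt_s; rewrite Dt !pcompE !permKV lex_x lex_y; lia.
Qed.

Lemma simD_tabP f J : tableau f -> J \in Int n -> simD (tab_interval f) J ->
  exists2 g, tableau g & J = tab_interval g.
Proof.
move=> tab_f; rewrite inE => /existsP[s /existsP[t /andP[/eqP -> /set0Pn[v]]]].
rewrite mem_intervalL => /andP[le_sv le_vt].
have le_st := leL_trans le_sv le_vt.
case/existsP=> h /andP[isoP /forall_inP desP].
have le_f := tab_interval_le tab_f.
have desP' : {in tab_interval f, forall u, DesL (h u) = DesL u}.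
  by move=> u /desP /eqP.
have hs := iso_bottom le_f le_st isoP.
have ht := iso_top le_f le_st isoP.
have bot_in : f^-1%g \in tab_interval f by rewrite mem_intervalL leL_refl.
have top_in : pcomp tau f^-1%g \in tab_interval f.
  by rewrite mem_intervalL le_f leL_refl.
(* The isomorphism multiplies both ends on the right by the same element, so the quotient of the top
   by the bottom is still [tau]. *)
have Dt : t = pcomp tau s.
  rewrite -ht (iso_shift le_f le_st isoP desP') //.
  by apply/permP=> k; rewrite !pcompE invgK permK.
exists s^-1%g; last by rewrite /tab_interval invgK Dt.
apply: (tableau_of_Des tab_f le_st Dt); first by rewrite -hs desP'.
by rewrite -ht desP'.
Qed.

Lemma mem_classD_tab f J : tableau f ->
  J \in classD (tab_interval f) <-> exists2 g, tableau g & J = tab_interval g.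
Proof.
move=> tab_f; rewrite inE; split=> [/andP[]|[g tab_g ->]]; first exact: simD_tabP.
by rewrite tab_interval_Int // simD_tab.
Qed.

(** The bottom ends are the inverses of the labellings, and inversion turns [leR] into [leL]. *)
Lemma leInt_tab f g : tableau f -> tableau g ->
  leInt (tab_interval f) (tab_interval g) = leL f g.
Proof.
move=> /tab_interval_le le_f /tab_interval_le le_g.
apply/idP/idP=> [|le_fg].
  case/existsP=> s /existsP[t /existsP[s' /existsP[t' /and5P[]]]].
  move=> le_st le_st' /eqP If /eqP Ig.
  have [<- _] := intervalL_inj le_f le_st If.
  have [<- _] := intervalL_inj le_g le_st' Ig.
  by rewrite leRE !invgK.
apply/existsP; exists f^-1%g; apply/existsP; exists (pcomp tau f^-1%g).
apply/existsP; exists g^-1%g; apply/existsP; exists (pcomp tau g^-1%g).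
by rewrite le_f le_g !eqxx leRE !invgK.
Qed.

End Points.

(** * Compositions *)

Section Levels.
Variable n : nat.
Implicit Types (g : 'S_n.+1) (i : 'I_n) (a b k l : 'I_n.+1) (z : 'I_n.+1 -> nat).

Lemma perm_of_order (R : rel 'I_n.+1) :
    total R -> transitive R -> antisymmetric R ->
  exists g, forall k l, R k l = (g k <= g l).
Proof.
move=> R_total R_trans R_anti; pose w := sort R (enum 'I_n.+1).
have sz_w : size w = n.+1 by rewrite size_sort size_enum_ord.
have mem_w k : k \in w by rewrite mem_sort mem_enum.
pose h k : 'I_n.+1 := inord (index k w).
have hE k : h k = index k w :> nat.
  by rewrite inordK //; have := mem_w k; rewrite -index_mem sz_w.
have h_inj : injective h.
  move=> k l /(congr1 val) /=; rewrite !hE => eq_kl.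
  by rewrite -(nth_index k (mem_w k)) eq_kl nth_index.
have R_refl : reflexive R by move=> k; have := R_total k k; rewrite orbb.
have h_le k l : h k <= h l -> R k l.
  rewrite !hE; apply: (sorted_leq_index R_trans R_refl) => //.
  exact: sort_sorted.
exists (perm h_inj) => k l; rewrite !permE.
apply/idP/idP=> [Rkl|]; last exact: h_le.
rewrite leqNgt; apply/negP=> lt_h.
have Rlk := h_le _ _ (ltnW lt_h).
by have Ekl := R_anti k l; move: lt_h; rewrite Ekl ?ltnn // Rkl.
Qed.

(** As [z] increases weakly along [g], the points of level below [m] occupy an initial segment of
    ranks, whose length is their number. *)
Lemma card_level z g (m : nat) k : (forall a b, g a <= g b -> z a <= z b) ->
  (g k < #|[set l | z l < m]|) = (z k < m).
Proof.
move=> z_mono; have [lt_zm|le_mz] := ltnP (z k) m.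
  have -> : (g k < #|[set l | z l < m]|) =
            (#|[set l | g l <= g k]| <= #|[set l | z l < m]|).
    congr (_ <= _); rewrite -(card_imset _ (@perm_inj _ g)).
    have -> : [set g l | l in [set l | g l <= g k]] =
              [set a : 'I_n.+1 | a < (g k).+1].
      apply/setP=> a; rewrite inE ltnS; apply/imsetP/idP=> [[l]|le_a].
        by rewrite inE => ? ->.
      by exists (g^-1 a)%g; rewrite ?inE permKV.
    by rewrite card_ord_lt // ltn_ord.
  apply/subset_leq_card/subsetP=> l; rewrite !inE => le_g.
  by have := z_mono _ _ le_g; lia.
apply/negbTE; rewrite -leqNgt.
have <- : #|[set l | g l < g k]| = g k by apply: card_perm_lt.
apply/subset_leq_card/subsetP=> l; rewrite !inE => lt_z; rewrite ltnNge.
by apply/negP=> le_g; have := z_mono _ _ le_g; lia.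
Qed.

(** The set [A] consists of the partial sums of the level sizes, so its blocks are the levels of [z]
    listed in the order of [g]. *)
Lemma bidx_level z g (A : {set 'I_n}) k l :
    (forall a b, g a <= g b -> z a <= z b) ->
    (forall i, reflect (exists m, i.+1 = #|[set k | z k < m]|) (i \in A)) ->
  g k < g l -> (bidx A (g k) == bidx A (g l)) = (z k == z l).
Proof.
move=> z_mono memA lt_g; rewrite (bidx_eq _ (ltnW lt_g)).
have le_z := z_mono _ _ (ltnW lt_g).
apply/forallP/eqP=> [noA|eq_z i].
  apply/eqP; rewrite eqn_leq le_z leqNgt; apply/negP=> lt_z.
  have ltN : g k < #|[set k | z k < z l]| by rewrite card_level.
  have geN : ~~ (g l < #|[set k | z k < z l]|) by rewrite card_level // ltnn.
  case DN: #|[set k | z k < z l]| ltN geN => [//|N] ltN geN.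
  have lt_N : N < n by have := ltn_ord (g l); lia.
  have /memA NA : exists m, (Ordinal lt_N).+1 = #|[set k | z k < m]|.
    by exists (z l).
  by have := noA (Ordinal lt_N); rewrite NA implybF /=; lia.
apply/implyP=> /andP[le_i lt_i]; apply/memA=> -[m Dm].
have := card_level m k z_mono; have := card_level m l z_mono.
by rewrite -Dm eq_z; lia.
Qed.

Definition level_comp z (N : nat) : seq nat :=
  [seq #|[set k | z k == j]| | j <- iota 0 N].

Lemma sumn_level_comp z (N m : nat) : m <= N ->
  sumn (take m (level_comp z N)) = #|[set k | z k < m]|.
Proof.
move=> le_mN; rewrite /level_comp -map_take take_iota (minn_idPl le_mN) {le_mN}.
elim: m => [|m IH].
  by apply/esym/eqP; rewrite cards_eq0; apply/eqP/setP=> k; rewrite !inE.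
rewrite -(addn1 m) iotaD map_cat sumn_cat IH /= add0n addn0 addn1.
rewrite -[RHS](cardsID [set k | z k < m]).
by congr (_ + _); apply: eq_card => k; rewrite !inE; lia.
Qed.

(** No bounds on [m] have to be stated: the values 0 and those from [N] on give the cardinals 0 and
    [n.+1], and [i.+1] is neither. *)
Lemma mem_set_of_comp z N i : (forall k, z k < N) ->
  reflect (exists m, i.+1 = #|[set k | z k < m]|)
    (i \in set_of_comp n (level_comp z N)).
Proof.
move=> lt_zN; have sz : size (level_comp z N) = N by rewrite size_map size_iota.
rewrite inE; apply: (iffP existsP) => [[k /andP[k_gt0 /eqP Di]]|[m Dm]].
  have lt_kN : k < N by rewrite -[X in _ < X]sz ltn_ord.
  by exists k; rewrite -(@sumn_level_comp z N) // ltnW.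
have [le_Nm|lt_mN] := leqP N m.
  have : #|[set k | z k < m]| = n.+1.
    rewrite -[RHS]card_ord -cardsT; apply: eq_card => k.
    by rewrite !inE (leq_trans (lt_zN k)).
  by rewrite -Dm => -[]; have := ltn_ord i; lia.
have m_gt0 : 0 < m.
  case: m Dm {lt_mN} => // Dm; suff: #|[set k | z k < 0]| = 0 by rewrite -Dm.
  by apply/eqP; rewrite cards_eq0; apply/eqP/setP=> k; rewrite !inE.
have lt_sz : m < size (level_comp z N) by rewrite sz.
exists (Ordinal lt_sz).
by rewrite /= m_gt0 (sumn_level_comp z (ltnW lt_mN)) -Dm eqxx.
Qed.

End Levels.

(** * Diagrams *)

Section Reading.
Variables (n : nat) (D : diagram n) (r : rel (box n)).
Variables (p : 'I_n.+1 -> boxes D) (g : 'S_n.+1).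
Hypothesis p_onto : forall b, exists k, p k = b.
Hypothesis r_p : forall k l, r (val (p k)) (val (p l)) = (g k <= g l).
Implicit Types (F : filling D) (k l : 'I_n.+1).

Lemma enumeration_inj : injective p.
Proof.
move=> k l eq_p; apply/(@perm_inj _ g)/val_inj/eqP.
by rewrite eqn_leq -!r_p eq_p r_p leqnn.
Qed.

(** Both lists contain all boxes once and are sorted for a total order, hence coincide. *)
Lemma readingE : reading r D = [seq p (g^-1%g k) | k <- enum 'I_n.+1].
Proof.
set rD := fun b c : boxes D => r (val b) (val c).
have pg_inj : injective (fun k => p (g^-1%g k)).
  by move=> k l /enumeration_inj /perm_inj.
have rD_total : total rD.
  move=> b c; have [k <-] := p_onto b; have [l <-] := p_onto c.
  by rewrite /rD !r_p leq_total.
have rD_trans : transitive rD.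
  move=> c b d; have [k <-] := p_onto b; have [l <-] := p_onto c.
  by have [m <-] := p_onto d; rewrite /rD !r_p; apply: leq_trans.
have rD_anti : antisymmetric rD.
  move=> b c; have [k <-] := p_onto b; have [l <-] := p_onto c.
  by rewrite /rD !r_p => /anti_leq/val_inj/perm_inj ->.
apply: (sorted_eq rD_trans rD_anti); first exact: sort_sorted.
  rewrite sorted_map.
  have rE : relpre (fun k => p (g^-1%g k)) rD =2 relpre val leq.
    by move=> k l /=; rewrite /rD r_p !permKV.
  by rewrite (eq_sorted rE) -sorted_map val_enum_ord iota_sorted.
rewrite perm_sort; apply: uniq_perm => [||b].
- exact: enum_uniq.
- by rewrite (map_inj_uniq pg_inj) enum_uniq.
rewrite mem_enum; apply/esym/mapP; have [k <-] := p_onto b.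
by exists (g k); rewrite ?mem_enum ?permK.
Qed.

Lemma fillE k : fill r D (p k) = g k.
Proof.
have pg_inj : injective (fun k => p (g^-1%g k)).
  by move=> l m /enumeration_inj /perm_inj.
apply: val_inj; rewrite /= ffunE readingE -{1}(permK g k).
by rewrite (index_map pg_inj) index_enum_ord inord_val.
Qed.

Lemma perm_of_readingE F k : injective F ->
  perm_of_word [seq F b | b <- reading r D] (g k) = F (p k).
Proof.
move=> F_inj; rewrite readingE -map_comp.
set w := map _ _; set h := [ffun l : 'I_n.+1 => nth ord0 w l].
have hE l : h l = F (p (g^-1%g l)).
  rewrite ffunE (nth_map ord0) ?size_enum_ord //=.
  by rewrite nth_ord_enum.
have h_inj : h \in (fun h : {ffun 'I_n.+1 -> 'I_n.+1} => injectiveb h).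
  by apply/injectiveP=> l m; rewrite !hE => /F_inj/enumeration_inj/perm_inj.
rewrite /perm_of_word -/h.
(* The default permutation is not reached, since the word is injective. *)
have -> : insubd (1%g : 'S_n.+1) h (g k) = h (g k).
  by rewrite -pvalE -[pval _]/(val _) insubdK.
by rewrite hE permK.
Qed.

End Reading.

(** * Reflection of diagrams and of fillings *)

Section Reflection.
Variables (n : nat) (D : diagram n).

Lemma nrows_gt (b : box n) : b \in D -> b.2 < nrows D.
Proof. by move=> Db; apply: (leq_bigmax_cond b Db). Qed.

Lemma ncols_gt (b : box n) : b \in D -> b.1 < ncols D.
Proof. by move=> Db; apply: (leq_bigmax_cond b Db). Qed.

Lemma reflx_box2 (b : box n) : (reflx_box D b).2 = (nrows D).-1 - b.2 :> nat.
Proof.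
rewrite /= inordK // ltnS; apply: leq_trans (leq_subr _ _) _.
have : nrows D <= n.+1 by apply/bigmax_leqP=> c _; apply: ltn_ord.
lia.
Qed.

Lemma reflx_boxK b : b \in D -> reflx_box D (reflx_box D b) = b.
Proof.
move=> Db; have lt_b := nrows_gt Db.
rewrite [RHS]surjective_pairing; congr (_, _); apply: val_inj.
rewrite -[LHS]/(nat_of_ord (reflx_box D (reflx_box D b)).2) !reflx_box2 /=; lia.
Qed.

Lemma reflx_le2 (b c : box n) : b \in D -> c \in D ->
  ((reflx_box D b).2 <= (reflx_box D c).2) = (c.2 <= b.2).
Proof. by move=> /nrows_gt lt_b /nrows_gt lt_c; rewrite !reflx_box2; lia. Qed.

Lemma reflx_in (b : boxes D) : reflx_box D (val b) \in reflx D.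
Proof. by apply: imset_f; apply: valP. Qed.

End Reflection.

(** Used with [reflx D] as the diagram: the poset is expressed on the boxes of [reflx D] itself,
    without transport along the equality of [reflx (reflx D)] and [D]. *)
Lemma P_reflx n (D : diagram n) (F : filling D) i j : P_ (reflx_filling F) i j =
  [exists b : boxes D, exists c : boxes D,
    [&& F b == i, F c == j, (val b).1 <= (val c).1 & (val c).2 <= (val b).2]].
Proof.
apply/existsP/existsP=> [[b /existsP[c /and4P[]]]|[b /existsP[c /and4P[]]]].
  rewrite !ffunE => Fb Fc le1 le2.
  exists (exist (fun d => d \in D) _ (reflx_box_mem (valP b))); apply/existsP.
  exists (exist (fun d => d \in D) _ (reflx_box_mem (valP c))).
  by rewrite Fb Fc le1 !reflx_box2 leq_sub2l.
move=> Fb Fc le1 le2.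
have reflK (d : boxes D) (Pd : reflx_box D (reflx_box D (val d)) \in D) :
    exist (fun b => b \in D) _ Pd = d.
  by apply: val_inj; rewrite /= reflx_boxK ?(valP d).
exists (exist (fun d => d \in reflx D) _ (reflx_in b)); apply/existsP.
exists (exist (fun d => d \in reflx D) _ (reflx_in c)).
rewrite !ffunE /= le1 reflx_le2 ?(valP b) ?(valP c) // le2 !andbT.
by rewrite !reflK Fb Fc.
Qed.

(** The class arises as an image of the set of tableaux, whereas the isomorphism sought starts from
    the class. The element of [U] is a default value outside the image. *)
Lemma poset_iso_inverse (T U : finType) (leT : rel T) (leU : rel U)
    (B : {set U}) (h : U -> T) :
    {in B &, injective h} -> {in B &, forall u v, leT (h u) (h v) = leU u v} ->
    U -> exists phi : T -> U, poset_iso leT (h @: B) leU B phi.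
Proof.
move=> h_inj h_le u0.
pose phi t := odflt u0 [pick u in B | h u == t].
have phiK u : u \in B -> phi (h u) = u.
  rewrite /phi => uB; case: pickP => [v /andP[vB /eqP huv]|/(_ u)].
    exact: h_inj.
  by rewrite /= uB eqxx.
exists phi; apply/and3P; split.
- apply/dinjectiveP=> _ _ /imsetP[u uB ->] /imsetP[v vB ->].
  by rewrite !phiK // => ->.
- rewrite -imset_comp; apply/eqP/setP=> u; apply/imsetP/idP=> [[v vB ->]|uB].
    by rewrite /= phiK.
  by exists u; rewrite //= phiK.
apply/forall_inP=> _ /imsetP[u uB ->]; apply/forall_inP=> _ /imsetP[v vB ->].
by rewrite !phiK // h_le.
Qed.

Lemma perm_eq_invs n (s t : 'S_n.+1) :
  (forall a b : 'I_n.+1, a < b -> (s b < s a) = (t b < t a)) -> s = t.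
Proof. by move=> st; apply: leL_anti; apply/leLP=> a b ab; rewrite st. Qed.

(* The boxes of [D] are the points of the section [Points]. Their reflections
   [rpt k] come in the order of [w_TL], so that [w_TL T] is the labelling of the
   points given by the tableau [T]. *)
Section DiagramClass.
Variables (n : nat) (D : diagram n) (pt : 'I_n.+1 -> boxes D) (tau : 'S_n.+1).
Hypothesis pt_onto : forall b, exists k, pt k = b.
Hypothesis up_pt : forall k l, up_cols (val (pt k)) (val (pt l)) = (k <= l).
Hypothesis bot_pt : forall k l,
  rows_bot (val (pt k)) (val (pt l)) = (tau k <= tau l).
Hypothesis free_D : free_upper_right D.
Implicit Types (g : 'S_n.+1) (k l : 'I_n.+1).

Let x k : nat := (val (pt k)).1.
Let y k : nat := (val (pt k)).2.
Local Notation tableau := (tableau x y).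
Local Notation tab_interval := (tab_interval tau).

Lemma points_inj : injective pt.
Proof.
move=> k l eq_pt; apply/val_inj/eqP.
by rewrite eqn_leq -!up_pt eq_pt up_pt leqnn.
Qed.

Lemma points_lex_x k l : (k < l) = (x k < x l) || (x k == x l) && (y k < y l).
Proof.
rewrite ltnNge -up_pt /up_cols -val_eqE /= -/(x k) -/(x l) -/(y k) -/(y l).
lia.
Qed.

Lemma points_lex_y k l :
  (tau k < tau l) = (y k < y l) || (y k == y l) && (x k < x l).
Proof.
rewrite ltnNge -bot_pt /rows_bot -val_eqE /= -/(x k) -/(x l) -/(y k) -/(y l).
lia.
Qed.

Lemma points_free k l : x k < x l -> y k < y l ->
  exists m, [/\ m != k, m != l, x k <= x m <= x l & y k <= y m <= y l].
Proof.
move=> xkl ykl; move: free_D.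
rewrite /free_upper_right negb_exists => /forallP/(_ (val (pt k))).
rewrite (valP (pt k)) /= negb_exists => /forallP/(_ (val (pt l))).
rewrite (valP (pt l)) /= -/(x k) -/(x l) -/(y k) -/(y l) xkl ykl /=.
rewrite negb_forall => /existsP[d].
rewrite !negb_imply => /andP[dD /andP[in_kl neq]].
have [m Em] := pt_onto (exist (fun b => b \in D) d dD).
have Dm : d = val (pt m) by rewrite Em.
move: in_kl neq; rewrite Dm negb_or => /andP[x_in y_in] /andP[neq_k neq_l].
by exists m; split=> //; [apply: contraNneq neq_k | apply: contraNneq neq_l] => ->.
Qed.

Lemma SigmaL_tab (P : rel 'I_n.+1) g : tableau g ->
    (forall k l, P (g k) (g l) = (x k <= x l) && (y k <= y l)) ->
  SigmaL P = tab_interval g.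
Proof.
move=> tab_g Pg; apply/setP=> u; rewrite inE.
apply/forallP/(mem_tab_interval points_lex_x points_lex_y _ tab_g).
  move=> mono k l xkl ykl.
  by have /forallP/(_ (g l))/implyP := mono (g k); rewrite Pg xkl ykl; apply.
move=> mono i; apply/forallP=> j; apply/implyP.
by rewrite -(permKV g i) -(permKV g j) Pg => /andP[]; apply: mono.
Qed.

Lemma SigmaL_filling (F : filling D) g : tableau g -> injective F ->
  (forall k, F (pt k) = g k) -> SigmaL (P_ F) = tab_interval g.
Proof.
move=> tab_g F_inj Fg; apply: SigmaL_tab => // k l.
apply/existsP/idP=> [[b /existsP[c /and4P[]]]|xy].
  by rewrite -!Fg => /eqP/F_inj -> /eqP/F_inj -> -> ->.
by exists (pt k); apply/existsP; exists (pt l); rewrite !Fg !eqxx.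
Qed.

Definition rpt k : boxes (reflx D) :=
  exist (fun b => b \in reflx D) _ (reflx_in (pt k)).

Lemma rpt_onto b : exists k, rpt k = b.
Proof.
have [k Dk] := pt_onto (exist (fun b => b \in D) _ (reflx_box_mem (valP b))).
exists k; apply: val_inj; rewrite /= Dk /=.
by have /imsetP[c Dc ->] := valP b; rewrite (reflx_boxK Dc).
Qed.

(** Reflection turns upward columns into downward ones, so [rpt k] has rank [k]; the identity
    permutation fits the form required by the lemmas on readings. *)
Lemma down_rpt k l :
  down_cols (val (rpt k)) (val (rpt l)) =
    ((1%g : 'S_n.+1) k <= (1%g : 'S_n.+1) l).
Proof.
by rewrite !perm1 -up_pt /down_cols /up_cols /= reflx_le2 ?(valP (pt _)).
Qed.

Lemma w_TLE (T : filling (reflx D)) k : injective T -> w_TL T k = T (rpt k).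
Proof.
move=> T_inj; have := perm_of_readingE rpt_onto down_rpt k T_inj.
by rewrite perm1.
Qed.

Lemma ST_inj (T : filling (reflx D)) : T \in ST (reflx D) -> injective T.
Proof. by rewrite inE => /andP[/andP[/injectiveP]]. Qed.

Lemma ST_tableau (T : filling (reflx D)) : T \in ST (reflx D) -> tableau (w_TL T).
Proof.
move=> TST k l xkl ylk; rewrite !w_TLE; try exact: ST_inj.
move: TST; rewrite inE => /andP[_ /forallP/(_ (rpt k))/forallP/(_ (rpt l))/implyP].
by apply; rewrite /= reflx_le2 ?(valP (pt _)) // -/(x k) -/(x l) xkl.
Qed.

Lemma SigmaL_ST (T : filling (reflx D)) : T \in ST (reflx D) ->
  SigmaL (P_ (reflx_filling T)) = tab_interval (w_TL T).
Proof.
move=> TST; have T_inj := ST_inj TST.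
apply: SigmaL_tab => [|k l]; first exact: ST_tableau.
have yE (p q : 'I_n.+1) : ((val (rpt p)).2 <= (val (rpt q)).2) = (y q <= y p).
  by rewrite /= reflx_le2 ?(valP (pt _)).
rewrite P_reflx !w_TLE //; apply/existsP/idP.
  case=> b /existsP[c /and4P[]].
  by move=> /eqP/T_inj -> /eqP/T_inj ->; rewrite yE => -> ->.
case/andP=> xkl ykl; exists (rpt k); apply/existsP; exists (rpt l).
by rewrite !eqxx yE ykl andbT.
Qed.

Lemma tableau_ST g : tableau g -> exists2 T, T \in ST (reflx D) & w_TL T = g.
Proof.
move=> tab_g.
(* The filling by [down_cols] recovers the number [k] of the box [rpt k]. *)
pose T : filling (reflx D) := [ffun b => g (fill (@down_cols n) (reflx D) b)].
have Tr k : T (rpt k) = g k by rewrite ffunE (fillE rpt_onto down_rpt) perm1.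
have T_inj : injective T.
  move=> b c; have [k <-] := rpt_onto b; have [l <-] := rpt_onto c.
  by rewrite !Tr => /perm_inj ->.
exists T; last by apply/permP=> k; rewrite w_TLE.
rewrite inE; apply/andP; split.
  apply/andP; split; first exact/injectiveP.
  apply/forallP=> i; rewrite -(permKV g i) -Tr; exact: codom_f.
apply/forallP=> b; apply/forallP=> c; apply/implyP.
have [k <-] := rpt_onto b; have [l <-] := rpt_onto c.
by rewrite !Tr /= reflx_le2 ?(valP (pt _)) // => /andP[]; apply: tab_g.
Qed.

Lemma w_TL_inj : {in ST (reflx D) &, injective (@w_TL n (reflx D))}.
Proof.
move=> T U /ST_inj T_inj /ST_inj U_inj eq_w; apply/ffunP=> b.
by have [k <-] := rpt_onto b; rewrite -!w_TLE // eq_w.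
Qed.

(** * The class of a tableau interval and its extreme elements *)

Section Class.
Variable f : 'S_n.+1.
Hypothesis tab_f : tableau f.
Let C := classD (tab_interval f).

Let mem_C J : J \in C <-> exists2 g, tableau g & J = tab_interval g.
Proof.
exact: (mem_classD_tab points_lex_x points_lex_y points_free).
Qed.

Let le_C := leInt_tab points_lex_x points_lex_y.

Lemma class_ST : C = [set SigmaL (P_ (reflx_filling T)) | T in ST (reflx D)].
Proof.
apply/setP=> J; apply/idP/imsetP=> [/mem_C[g tab_g ->]|[T TST ->]].
  by have [T TST <-] := tableau_ST tab_g; exists T; rewrite // SigmaL_ST.
by apply/mem_C; exists (w_TL T); rewrite ?SigmaL_ST //; apply: ST_tableau.
Qed.

Lemma class_iso : exists phi : {set 'S_n.+1} -> filling (reflx D),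
  poset_iso (@leInt n) C (@leST n (reflx D)) (ST (reflx D)) phi.
Proof.
rewrite class_ST; apply: poset_iso_inverse; last exact: [ffun=> ord0].
  move=> T U TST UST; rewrite !SigmaL_ST // => eqI.
  apply: w_TL_inj => //.
  by apply: (tab_interval_inj points_lex_x points_lex_y _ _ eqI); apply: ST_tableau.
by move=> T U TST UST; rewrite !SigmaL_ST // le_C //; apply: ST_tableau.
Qed.

Lemma order_points (r : rel (box n)) :
    total r -> transitive r -> antisymmetric r ->
  exists g, forall k l, r (val (pt k)) (val (pt l)) = (g k <= g l).
Proof.
move=> r_total r_trans r_anti.
apply: (perm_of_order (R := fun k l => r (val (pt k)) (val (pt l)))).
- by move=> k l; apply: r_total.
- by move=> l k m; apply: r_trans.
by move=> k l /r_anti/val_inj/points_inj.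
Qed.

Lemma card_points (Q : pred (box n)) :
  #|[set b in D | Q b]| = #|[set k | Q (val (pt k))]|.
Proof.
have pt_inj : injective (fun k => val (pt k)) by move=> k l /val_inj/points_inj.
rewrite -(card_imset _ pt_inj); apply: eq_card => b; rewrite inE.
apply/andP/imsetP=> [[bD Qb]|[k]]; last first.
  by rewrite inE => Qk ->; rewrite (valP (pt k)).
have [k Dk] := pt_onto (exist (fun b => b \in D) b bD).
by exists k; rewrite ?inE Dk.
Qed.

Lemma T'E k : T'_ D (pt k) = k.
Proof.
have up_pt1 p q : up_cols (val (pt p)) (val (pt q)) =
    ((1%g : 'S_n.+1) p <= (1%g : 'S_n.+1) q).
  by rewrite !perm1.
by rewrite /T'_ (fillE pt_onto up_pt1) perm1.
Qed.

Lemma TE k : T_ D (pt k) = tau k.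
Proof. exact: fillE. Qed.

Lemma injective_of_points (F : filling D) g :
  (forall k, F (pt k) = g k) -> injective F.
Proof.
move=> Fg b c; have [k <-] := pt_onto b; have [l <-] := pt_onto c.
by rewrite !Fg => /perm_inj ->.
Qed.

Lemma T'_inj : injective (T'_ D).
Proof. by apply: (injective_of_points (g := 1%g)) => k; rewrite T'E perm1. Qed.

Lemma T_inj : injective (T_ D).
Proof. exact: (injective_of_points TE). Qed.

(** If a tableau inverts a pair [k < l], then [l] lies strictly above [k]; [F_right] reads higher
    rows first and inverts all such pairs. *)
Lemma class_max :
  is_max (@leInt n) C (SigmaL (P_ (F_right D))) /\
  SigmaL (P_ (F_right D)) =
    intervalL (w_LT (T'_ D)) (w1 (set_of_comp n (row_comp D))).
Proof.
have [||| g rows_g] := @order_points (@rows_top n).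
- by move=> b c; rewrite /rows_top -!val_eqE /=; lia.
- by move=> b c d; rewrite /rows_top -!val_eqE /=; lia.
- move=> b c; rewrite /rows_top -!val_eqE /= => h.
  rewrite [b]surjective_pairing [c]surjective_pairing.
  by congr (_, _); apply: val_inj => /=; lia.
have gE k : F_right D (pt k) = g k by apply: fillE.
have F_inj := injective_of_points gE.
have g_lt k l : (g k < g l) = (y l < y k) || (y k == y l) && (x k < x l).
  rewrite ltnNge -rows_g /rows_top -val_eqE /=.
  by rewrite -/(x k) -/(x l) -/(y k) -/(y l); lia.
have tab_g : tableau g.
  by move=> k l xkl ylk; rewrite leqNgt g_lt; lia.
rewrite (SigmaL_filling tab_g F_inj gE); split.
  split; first by apply/mem_C; exists g.
  move=> _ /mem_C[h tab_h ->]; rewrite le_C //; apply/leLP=> k l lt_kl lt_h.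
  have := tab_h k l; move: lt_kl; rewrite points_lex_x g_lt; lia.
congr intervalL.
  apply/permP=> a; rewrite -(permKV g a) permK; apply/esym.
  by rewrite /w_LT (perm_of_readingE pt_onto rows_g _ T'_inj) T'E.
apply: perm_eq_invs => a b; rewrite -{1}(permKV g a) -{1}(permKV g b) => lt_g.
have := lt_g; rewrite !permKV => /w1_inv ->; rewrite !pcompE.
rewrite -{2}(permKV g a) -{2}(permKV g b).
move: (g^-1%g a) (g^-1%g b) lt_g => k l lt_g.
(* Rows are numbered from the top, as in [row_comp]. Two labels are inverted in the top element
   exactly when their rows differ, which is also the rule for [w1]. *)
pose z p := (nrows D).-1 - y p.
have lt_y p : y p < nrows D := nrows_gt (valP (pt p)).
have z_lt p : z p < nrows D by have := lt_y p; rewrite /z; lia.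
have -> : row_comp D = level_comp z (nrows D).
  apply: (@eq_from_nth _ 0); first by rewrite size_rev !size_map.
  move=> i; rewrite size_rev size_map size_iota => lt_i.
  rewrite nth_rev ?size_map ?size_iota // !(nth_map 0) ?size_iota //; last by lia.
  rewrite !nth_iota //; last by lia.
  rewrite card_points; apply: eq_card => p; rewrite !inE -/(y p) /z.
  by have := lt_y p; lia.
have z_mono p q : g p <= g q -> z p <= z q.
  by rewrite leqNgt g_lt /z; lia.
rewrite (bidx_level z_mono _ lt_g); last by move=> i; apply: mem_set_of_comp.
move: lt_g; rewrite g_lt points_lex_y /z; have := lt_y k; have := lt_y l; lia.
Qed.

(** [F_down] inverts only pairs within a column, and these are inverted by every tableau. Likewise
    the bottom element inverts two labels exactly when their columns agree, as [w0] does. *)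
Lemma class_min :
  is_min (@leInt n) C (SigmaL (P_ (F_down D))) /\
  SigmaL (P_ (F_down D)) =
    intervalL (w0 (~: set_of_comp n (col_comp D))) (w_TL (T_ D)).
Proof.
have [||| g cols_g] := @order_points (@down_cols n).
- by move=> b c; rewrite /down_cols -!val_eqE /=; lia.
- by move=> b c d; rewrite /down_cols -!val_eqE /=; lia.
- move=> b c; rewrite /down_cols -!val_eqE /= => h.
  rewrite [b]surjective_pairing [c]surjective_pairing.
  by congr (_, _); apply: val_inj => /=; lia.
have gE k : F_down D (pt k) = g k by apply: fillE.
have F_inj := injective_of_points gE.
have g_lt k l : (g k < g l) = (x k < x l) || (x k == x l) && (y l < y k).
  rewrite ltnNge -cols_g /down_cols -val_eqE /=.
  by rewrite -/(x k) -/(x l) -/(y k) -/(y l); lia.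
have tab_g : tableau g.
  by move=> k l xkl ylk; rewrite leqNgt g_lt; lia.
rewrite (SigmaL_filling tab_g F_inj gE); split.
  split; first by apply/mem_C; exists g.
  move=> _ /mem_C[h tab_h ->]; rewrite le_C //; apply/leLP=> k l lt_kl lt_g.
  apply: perm_ltn_neq; first by apply: contraTneq lt_kl => ->; rewrite ltnn.
  by apply: tab_h; move: lt_kl lt_g; rewrite points_lex_x g_lt; lia.
congr intervalL; last first.
  apply/permP=> a; rewrite -(permKV g a) pcompE permK; apply/esym.
  by rewrite /w_TL (perm_of_readingE pt_onto cols_g _ T_inj) TE.
apply: perm_eq_invs => a b; rewrite -{1}(permKV g a) -{1}(permKV g b) => lt_g.
have := lt_g; rewrite !permKV => /w0_inv ->; rewrite setCK.
rewrite -{2}(permKV g a) -{2}(permKV g b).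
move: (g^-1%g a) (g^-1%g b) lt_g => k l lt_g.
have x_lt p : x p < ncols D := ncols_gt (valP (pt p)).
have -> : col_comp D = level_comp x (ncols D).
  by apply: eq_map => i; rewrite card_points.
have x_mono p q : g p <= g q -> x p <= x q.
  by rewrite leqNgt g_lt; lia.
rewrite (bidx_level x_mono _ lt_g); last by move=> i; apply: mem_set_of_comp.
by move: lt_g; rewrite g_lt points_lex_x; lia.
Qed.

End Class.
End DiagramClass.

(** * The diagrams of the two classes *)

Section SetPerm.
Variables (n : nat) (S : {set 'I_n}) (rho : 'S_n.+1).
Hypothesis w0_rho : leL (w0 S) rho.
Implicit Types p q k l : 'I_n.+1.

Let X p := bidx (~: S) p.
Let Y p := bidx (DesL rho) (rho p).

Lemma bidx_ord A k : @bidx n A k < n.+1.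
Proof.
by rewrite ltnS (leq_trans (bidx_le A k)) // -[X in _ <= X](card_ord n) max_card.
Qed.

Definition set_perm_box p : box n :=
  (Ordinal (bidx_ord (~: S) p), Ordinal (bidx_ord (DesL rho) (rho p))).

Lemma mem_D_set_perm b : b \in D_set_perm S rho <-> exists p, set_perm_box p = b.
Proof.
rewrite inE; split=> [/set0Pn[c /setIP[/imsetP[p]]]|[p <-]].
  rewrite !mem_block => /eqP b1 -> /eqP b2; exists p.
  by rewrite [b]surjective_pairing; congr (_, _); apply: val_inj.
apply/set0Pn; exists (rho p); apply/setIP.
by split; [apply: imset_f|]; rewrite mem_block.
Qed.

Let X_mono p q : p <= q -> X p <= X q. Proof. exact: bidx_mono. Qed.
Let Y_mono p q : rho p <= rho q -> Y p <= Y q. Proof. exact: bidx_mono. Qed.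

Let rho_col p q : p < q -> X p = X q -> rho q < rho p.
Proof.
by move=> lt_pq /eqP eq_X; apply: (leLP _ _ w0_rho) => //; rewrite w0_inv.
Qed.

Let rho_row p q : rho p < rho q -> Y p = Y q -> p < q.
Proof.
move=> lt_rho /eqP; rewrite /Y (bidx_eq _ (ltnW lt_rho)) => /forallP noDes.
rewrite -(permK rho p) -(permK rho q).
apply: (ord_ascending (f := fun k => rho^-1%g k) lt_rho) => i i_in.
by rewrite -notin_DesL; have /implyP := noDes i; apply.
Qed.

(** Along a column [rho] decreases with the position, along a row it increases; hence each box comes
    from a single position. *)
Let XY_inj p q : X p = X q -> Y p = Y q -> p = q.
Proof.
move=> eq_X eq_Y; have [lt_pq|lt_qp|/val_inj //] := ltngtP p q.
  by have := rho_row (rho_col lt_pq eq_X) (esym eq_Y); lia.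
by have := rho_row (rho_col lt_qp (esym eq_X)) eq_Y; lia.
Qed.

Let XY_lt p q : p != q -> rho p < rho q ->
  (Y p < Y q) || (Y p == Y q) && (X p < X q).
Proof.
move=> neq lt_rho; have := Y_mono (ltnW lt_rho).
rewrite leq_eqVlt => /orP[/eqP eq_Y|-> //].
have := X_mono (ltnW (rho_row lt_rho eq_Y)).
have : X p != X q by apply: contra_neq neq => /XY_inj; apply.
by rewrite eq_Y; lia.
Qed.

Lemma set_perm_bot p q :
  rows_bot (set_perm_box p) (set_perm_box q) = (rho p <= rho q).
Proof.
rewrite /rows_bot -val_eqE /= -/(X p) -/(X q) -/(Y p) -/(Y q).
have [->|neq] := eqVneq p q; first by rewrite !leqnn eqxx orbT.
have neq' : q != p by rewrite eq_sym.
have [lt_rho|lt_rho|/val_inj/perm_inj eq_pq] := ltngtP (rho p) (rho q).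
- by have := XY_lt neq lt_rho; lia.
- by have := XY_lt neq' lt_rho; lia.
- by rewrite eq_pq eqxx in neq.
Qed.

(** [w0 S] keeps the order of the columns and reverses each of them, where the rows go down as the
    position grows, since [rho] decreases. *)
Lemma set_perm_up p q :
  up_cols (set_perm_box p) (set_perm_box q) = (w0 S p <= w0 S q).
Proof.
rewrite /up_cols -val_eqE /= -/(X p) -/(X q) -/(Y p) -/(Y q).
wlog lt_pq : p q / p < q => [th|].
  have [/th //|lt_qp|/val_inj ->] := ltngtP p q; last by rewrite !leqnn eqxx orbT.
  have := th _ _ lt_qp; have neq := perm_neq (w0 S) lt_qp.
  have : ~ (X p = X q /\ Y p = Y q).
    by case=> eq_X eq_Y; move: lt_qp; rewrite (XY_inj eq_X eq_Y) ltnn.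
  lia.
rewrite (leqNgt (w0 S p)) (w0_inv _ lt_pq) -/(X p) -/(X q).
have := X_mono (ltnW lt_pq); rewrite leq_eqVlt => /orP[/eqP eq_X|lt_X].
  have := Y_mono (ltnW (rho_col lt_pq eq_X)).
  have : Y p <> Y q by move=> eq_Y; move: lt_pq; rewrite (XY_inj eq_X eq_Y) ltnn.
  by rewrite eq_X; lia.
lia.
Qed.

(** The labelling of the boxes by positions is thus a tableau, which makes the given interval a
    [tab_interval]. *)
Lemma set_perm_tableau p q : X p <= X q -> Y q <= Y p -> p <= q.
Proof.
move=> le_X le_Y; rewrite leqNgt; apply/negP=> lt_qp.
have eq_X : X q = X p by have := X_mono (ltnW lt_qp); lia.
have lt_rho := rho_col lt_qp eq_X.
have eq_Y : Y q = Y p by have := Y_mono (ltnW lt_rho); lia.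
by move: lt_qp; rewrite (XY_inj eq_X eq_Y) ltnn.
Qed.

End SetPerm.

(** * The diagram attached to [sigma] and [S] *)

Section PermSet.
Variables (n : nat) (S : {set 'I_n}) (sigma : 'S_n.+1).
Hypothesis sigma_w1 : leL sigma (w1 S).
Implicit Types p q k l : 'I_n.+1.

Local Notation colIx p := (bidx (~: DesL sigma) (sigma p)).
Local Notation blkIx p := (bidx S p).

Lemma row_ord p : #|S| - bidx S p < n.+1.
Proof.
rewrite ltnS (leq_trans (leq_subr _ _)) // -[X in _ <= X](card_ord n).
exact: max_card.
Qed.

(** The blocks of [S] are the rows listed from the top, whereas row indices start at the bottom;
    hence the subtraction. *)
Definition perm_set_box p : box n :=
  (Ordinal (bidx_ord (~: DesL sigma) (sigma p)), Ordinal (row_ord p)).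

Lemma mem_D_perm_set b : b \in D_perm_set sigma S <-> exists p, perm_set_box p = b.
Proof.
rewrite inE; split=> [/existsP[i /andP[/eqP b2 /set0Pn[c]]]|[p <-]].
  case/setIP=> /imsetP[p]; rewrite !mem_block => /eqP Di -> /eqP b1; exists p.
  rewrite [b]surjective_pairing; congr (_, _); apply: val_inj => //=.
  by rewrite b2 Di.
have lt_B : bidx S p < #|S|.+1 by rewrite ltnS bidx_le.
apply/existsP; exists (Ordinal lt_B); rewrite eqxx /=.
apply/set0Pn; exists (sigma p); apply/setIP.
by split; [apply: imset_f|]; rewrite mem_block.
Qed.

Let X_mono p q : sigma p <= sigma q -> colIx p <= colIx q.
Proof. exact: bidx_mono. Qed.
Let B_mono p q : p <= q -> blkIx p <= blkIx q. Proof. exact: bidx_mono. Qed.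

Let sigma_row p q : p < q -> blkIx p = blkIx q -> sigma p < sigma q.
Proof.
move=> lt_pq eq_B.
have [//|lt_s|/val_inj/perm_inj eq_pq] := ltngtP (sigma p) (sigma q).
  have := leLP _ _ sigma_w1 _ _ lt_pq lt_s.
  by rewrite (w1_inv _ lt_pq) eq_B eqxx.
by move: lt_pq; rewrite eq_pq ltnn.
Qed.

Let sigma_col p q : sigma p < sigma q -> colIx p = colIx q -> q < p.
Proof.
move=> lt_s /eqP; rewrite (bidx_eq _ (ltnW lt_s)) => /forallP inDes.
rewrite -(permK sigma p) -(permK sigma q).
apply: (ord_descending lt_s) => i i_in.
by rewrite -mem_DesL; have := inDes i; rewrite i_in in_setC negbK.
Qed.

(** Within a row [sigma] increases with the position, as [w1 S] has no inversion there; within a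
    column it decreases. *)
Let XB_inj p q : colIx p = colIx q -> blkIx p = blkIx q -> p = q.
Proof.
move=> eq_X eq_B; have [lt_pq|lt_qp|/val_inj //] := ltngtP p q.
  by have := sigma_col (sigma_row lt_pq eq_B) eq_X; lia.
by have := sigma_col (sigma_row lt_qp (esym eq_B)) (esym eq_X); lia.
Qed.

Let row_le p q : (#|S| - blkIx p <= #|S| - blkIx q) = (blkIx q <= blkIx p).
Proof. by rewrite leq_sub2lE ?bidx_le. Qed.

Let XB_lt p q : p != q -> sigma p < sigma q ->
  (colIx p < colIx q) || (colIx p == colIx q) && (blkIx q < blkIx p).
Proof.
move=> neq lt_s; have := X_mono (ltnW lt_s).
rewrite leq_eqVlt => /orP[/eqP eq_X|-> //].
have := B_mono (ltnW (sigma_col lt_s eq_X)).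
have : blkIx p != blkIx q by apply: contra_neq neq => /(XB_inj eq_X).
by rewrite eq_X; lia.
Qed.

Lemma perm_set_up p q :
  up_cols (perm_set_box p) (perm_set_box q) = (sigma p <= sigma q).
Proof.
rewrite /up_cols -val_eqE /= row_le.
have [->|neq] := eqVneq p q; first by rewrite !leqnn eqxx orbT.
have neq' : q != p by rewrite eq_sym.
have [lt_s|lt_s|/val_inj/perm_inj eq_pq] := ltngtP (sigma p) (sigma q).
- by have := XB_lt neq lt_s; lia.
- by have := XB_lt neq' lt_s; lia.
- by rewrite eq_pq eqxx in neq.
Qed.

(** [w1 S] inverts exactly the pairs in different blocks, so it lists the last block, which is the
    bottom row, first and keeps the order inside each row. *)
Lemma perm_set_bot p q :
  rows_bot (perm_set_box p) (perm_set_box q) = (w1 S p <= w1 S q).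
Proof.
rewrite /rows_bot -val_eqE /= ltnNge eqn_leq !row_le.
wlog lt_pq : p q / p < q => [th|].
  have [/th //|lt_qp|/val_inj ->] := ltngtP p q; last by rewrite !leqnn.
  have := th _ _ lt_qp; have neq := perm_neq (w1 S) lt_qp.
  have : ~ (colIx p = colIx q /\ blkIx p = blkIx q).
    by case=> eq_X eq_B; move: lt_qp; rewrite (XB_inj eq_X eq_B) ltnn.
  lia.
rewrite (leqNgt (w1 S p)) (w1_inv _ lt_pq).
have := B_mono (ltnW lt_pq); rewrite leq_eqVlt => /orP[/eqP eq_B|lt_B].
  by have := X_mono (ltnW (sigma_row lt_pq eq_B)); rewrite eq_B; lia.
lia.
Qed.

Lemma perm_set_tableau p q : colIx p <= colIx q ->
  #|S| - blkIx q <= #|S| - blkIx p -> p <= q.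
Proof.
rewrite row_le => le_X le_B; rewrite leqNgt; apply/negP=> lt_qp.
have eq_B : blkIx q = blkIx p by have := B_mono (ltnW lt_qp); lia.
have lt_s := sigma_row lt_qp eq_B.
have eq_X : colIx q = colIx p by have := X_mono (ltnW lt_s); lia.
by move: lt_qp; rewrite (XB_inj eq_X eq_B) ltnn.
Qed.

End PermSet.

Theorem theorem4p16 (n : nat) (S : {set 'I_n}) (rho sigma : 'S_n.+1)
    (w0_rho : leL (w0 S) rho) (sigma_w1 : leL sigma (w1 S)) :
  let C_S_rho := classD (intervalL (w0 S) rho) in
  let C_sigma_S := classD (intervalL sigma (w1 S)) in
  let D := D_set_perm S rho in
  let E := D_perm_set sigma S in
  (free_upper_right D ->
     [/\ is_max (@leInt n) C_S_rho (SigmaL (P_ (F_right D))),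
         SigmaL (P_ (F_right D))
           = intervalL (w_LT (T'_ D)) (w1 (set_of_comp n (row_comp D))),
         C_S_rho = [set SigmaL (P_ (reflx_filling T)) | T in ST (reflx D)]
       & exists phi : {set 'S_n.+1} -> filling (reflx D),
           poset_iso (@leInt n) C_S_rho (@leST n (reflx D)) (ST (reflx D)) phi])
  /\
  (free_upper_right E ->
     [/\ is_min (@leInt n) C_sigma_S (SigmaL (P_ (F_down E))),
         SigmaL (P_ (F_down E))
           = intervalL (w0 (~: set_of_comp n (col_comp E))) (w_TL (T_ E)),
         C_sigma_S = [set SigmaL (P_ (reflx_filling T)) | T in ST (reflx E)]
       & exists phi : {set 'S_n.+1} -> filling (reflx E),
           poset_iso (@leInt n) C_sigma_S (@leST n (reflx E)) (ST (reflx E)) phi]).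
Proof.
move=> C_S_rho C_sigma_S D E; split=> [free_D|free_E].
  have boxD p : set_perm_box S rho p \in D by apply/mem_D_set_perm; exists p.
  (* The point [k] is the box of the position that [w0 S] sends to [k]. This position is its label,
     and [tau] turns ranks by columns into ranks by rows. *)
  pose pt k := exist (fun b => b \in D) _ (boxD ((w0 S)^-1%g k)).
  pose tau := pcomp rho (w0 S)^-1%g.
  have pt_onto b : exists k, pt k = b.
    have /mem_D_set_perm[p Dp] := valP b.
    by exists (w0 S p); apply: val_inj; rewrite /= permK.
  have up_pt k l : up_cols (val (pt k)) (val (pt l)) = (k <= l).
    by rewrite /= set_perm_up // !permKV.
  have bot_pt k l : rows_bot (val (pt k)) (val (pt l)) = (tau k <= tau l).
    by rewrite /= set_perm_bot // !pcompE.
  have tab : tableau (fun k => (val (pt k)).1) (fun k => (val (pt k)).2) (w0 S)^-1%g.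
    by move=> k l; apply: set_perm_tableau.
  have DC : C_S_rho = classD (tab_interval tau (w0 S)^-1%g).
    by rewrite /C_S_rho /tab_interval invgK /tau /pcomp mulgA mulgV mul1g.
  have [maxC intC] := class_max pt_onto up_pt bot_pt free_D tab.
  rewrite DC; split=> //; first exact: (class_ST pt_onto up_pt bot_pt free_D tab).
  exact: (class_iso pt_onto up_pt bot_pt free_D tab).
have boxE p : perm_set_box S sigma p \in E by apply/mem_D_perm_set; exists p.
(* Here [sigma] gives the rank of a position by columns and [w1 S] its rank by rows. *)
pose pt k := exist (fun b => b \in E) _ (boxE (sigma^-1%g k)).
pose tau := pcomp (w1 S) sigma^-1%g.
have pt_onto b : exists k, pt k = b.
  have /mem_D_perm_set[p Dp] := valP b.
  by exists (sigma p); apply: val_inj; rewrite /= permK.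
have up_pt k l : up_cols (val (pt k)) (val (pt l)) = (k <= l).
  by rewrite /= perm_set_up // !permKV.
have bot_pt k l : rows_bot (val (pt k)) (val (pt l)) = (tau k <= tau l).
  by rewrite /= perm_set_bot // !pcompE.
have tab : tableau (fun k => (val (pt k)).1) (fun k => (val (pt k)).2) sigma^-1%g.
  by move=> k l; apply: perm_set_tableau.
have EC : C_sigma_S = classD (tab_interval tau sigma^-1%g).
  by rewrite /C_sigma_S /tab_interval invgK /tau /pcomp mulgA mulgV mul1g.
have [minC intC] := class_min pt_onto up_pt bot_pt free_E tab.
rewrite EC; split=> //; first exact: (class_ST pt_onto up_pt bot_pt free_E tab).
exact: (class_iso pt_onto up_pt bot_pt free_E tab).
Qed.
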